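(* Let $H_1,H_2:\overline U\times\mathbb R^n\to\mathbb R$ and $\psi_1,\psi_2:\overline U\to\mathbb R$ be smooth, with $\psi_1,\psi_2\ge\alpha$ in $\overline U$ for some $\alpha>0$. Assume for $j=1,2$: (1) $H_j(x,\cdot)$ is convex for every $x\in\overline U$; (2) $\lim_{|p|\to\infty}\frac{H_j(x,p)}{|p|}=+\infty$ uniformly in $x$; (3) there is a constant $K$ with $|D_xH_j(x,p)|\le K$ for all $(x,p)\in\overline U\times\mathbb R^n$; (4) there exist $\Phi_1,\Phi_2\in C^2(U)\cap C^1(\overline U)$ with $\Phi_j=0$ on $\partial U$, $-\psi_2\le\Phi_1-\Phi_2\le\psi_1$, and $\Phi_j+H_j(x,D\Phi_j)<0$ in $\overline U$. Let $(u_1,u_2)$ be the viscosity solution of $$\begin{cases}\max\{u_1-u_2-\psi_1,\ u_1+H_1(x,Du_1)\}=0 \\ \max\{u_2-u_1-\psi_2,\ u_2+H_2(x,Du_2)\}=0\end{cases}\ \text{in }U,\qquad u_1=u_2=0\text{ on }\partial U,$$ and for $\varepsilon>0$ let $(u_1^\varepsilon,u_2^\varepsilon)$ be the smooth solution of $$\begin{cases} u_1^\varepsilon+H_1(x,Du_1^\varepsilon)+\gamma^\varepsilon(u_1^\varepsilon-u_2^\varepsilon-\psi_1)=\varepsilon\Delta u_1^\varepsilon \\ {} u_2^\varepsilon+H_2(x,Du_2^\varepsilon)+\gamma^\varepsilon(u_2^\varepsilon-u_1^\varepsilon-\psi_2)=\varepsilon\Delta u_2^\varepsilon\end{cases}\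 \text{in }U,\qquad u_1^\varepsilon=u_2^\varepsilon=0\text{ on }\partial U.$$ Then there exist $\varepsilon_0>0$ and a constant $C>0$, independent of $\varepsilon$, such that for all $\varepsilon\in(0,\varepsilon_0)$ $$\|u_i^\varepsilon-u_i\|_{L^\infty}\le C\varepsilon^{1/2},\qquad i=1,2.$$
   Context: $U\subset\mathbb R^n$ ($n\ge2$) is an open bounded domain with smooth boundary. $\gamma:\mathbb R\to[0,+\infty)$ is smooth and convex with $\gamma(s)=0$ for $s\le0$, $\gamma(s)>0$ and $0<\gamma'(s)\le1$ for $s>0$, and $\lim_{s\to+\infty}\gamma(s)=+\infty$; $\gamma^\varepsilon(s):=\gamma(s/\varepsilon)$. The $\varepsilon$-system is the penalized approximation of the obstacle system. A pair of continuous functions is a viscosity solution of the obstacle system if each component is a viscosity solution of its equation with the other component regarded as a given continuous function. *)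

(* Defs.v *)
From HB Require Import structures.
From mathcomp Require Import all_boot all_order all_algebra.
From mathcomp Require Import all_classical all_reals all_analysis.

Set Implicit Arguments.
Unset Strict Implicit.
Unset Printing Implicit Defensive.

Import Order.TTheory GRing.Theory Num.Theory.
Import numFieldNormedType.Exports.

Local Open Scope classical_set_scope.
Local Open Scope ring_scope.

(* The norm provided by the library on 'rV[R]_n is the sup norm. *)
Definition enorm (R : realType) (n : nat) (p : 'rV[R]_n) : R :=
  Num.sqrt (\sum_(i < n) p 0 i ^+ 2).

Definition boundary (T : topologicalType) (A : set T) : set T :=
  closure A `\` interior A.

(* All directions are allowed, not only those of a basis; on a
   finite-dimensional space this yields the usual classes C^k, and it treats
   'rV[R]_n, products of such spaces, and R uniformly. *)
Definition iter_derive (R : realType) (V : normedModType R) (vs : seq V)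
    (f : V -> R) : V -> R :=
  foldr (fun v g => 'D_v g) f vs.

(* Meant for open D. *)
Definition Ck (R : realType) (V : normedModType R) (k : nat) (D : set V)
    (f : V -> R) : Prop :=
  forall vs : seq V, (size vs <= k)%N -> forall x, D x ->
    {for x, continuous (iter_derive vs f)} /\
    ((size vs < k)%N -> forall v, derivable (iter_derive vs f) x v).

Definition smooth (R : realType) (V : normedModType R) (D : set V)
    (f : V -> R) : Prop :=
  forall k, Ck k D f.

(* C^k(closure D), for open D: the derivatives of order at most k, which make
   sense in D, extend continuously to closure D. The values of f outside
   closure D are irrelevant. *)
Definition Ck_closure (R : realType) (V : normedModType R) (k : nat)
    (D : set V) (f : V -> R) : Prop :=
  [/\ Ck k D f,
      {within closure D, continuous f} &
      forall vs : seq V, (size vs <= k)%N -> forall x, closure D x ->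
        cvg (iter_derive vs f y @[y --> within D (nbhs x)])].

Definition smooth_closure (R : realType) (V : normedModType R) (D : set V)
    (f : V -> R) : Prop :=
  forall k, Ck_closure k D f.

Section differential_operators.
Context (R : realType) (n : nat).
Implicit Types (f : 'rV[R]_n -> R) (x : 'rV[R]_n).

Definition partial (i : 'I_n) f : 'rV[R]_n -> R := 'D_(delta_mx 0 i) f.

Definition grad f x : 'rV[R]_n := \row_i partial i f x.

Definition laplacian f x : R := \sum_(i < n) partial i (partial i f) x.

(* The gradient at points of closure U, i.e., the continuous extension of the
   gradient from U; it is [grad f] on U when f is C^1 there. *)
Definition grad_closure (U : set 'rV[R]_n) f x : 'rV[R]_n :=
  \row_i lim (partial i f y @[y --> within U (nbhs x)]).

End differential_operators.

(* Near each boundary point, up to relabelling and reorienting the coordinate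
   axes, U is the region strictly above the graph of a smooth function of the
   n - 1 remaining coordinates. *)
Definition smooth_boundary (R : realType) (n : nat) (U : set 'rV[R]_n) : Prop :=
  forall x0, boundary U x0 ->
    exists (i : 'I_n) (b : bool) (g : 'rV[R]_n.-1 -> R),
      smooth setT g /\
      \forall x \near x0, U x <-> 0 < (-1) ^+ b * (x 0 i - g (col' i x)).

Definition smooth_bounded_domain (R : realType) (n : nat)
    (U : set 'rV[R]_n) : Prop :=
  [/\ U !=set0, open U, connected U, bounded_set U & smooth_boundary U].

Definition admissible_penalty (R : realType) (gamma : R -> R) : Prop :=
  [/\ smooth setT gamma,
      convex_function setT gamma,
      forall s, s <= 0 -> gamma s = 0,
      forall s, 0 < s -> 0 < gamma s /\ 0 < derive1 gamma s <= 1 &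
      gamma s @[s --> +oo] --> +oo].

Definition rescaled_penalty (R : realType) (gamma : R -> R) (eps s : R) : R :=
  gamma (s / eps).

Section hamilton_jacobi.
Context (R : realType) (n : nat).
Implicit Types (U : set 'rV[R]_n) (H : 'rV[R]_n -> 'rV[R]_n -> R).

(* lim_{|p| -> oo} H(x, p) / |p| = +oo, uniformly in x \in closure U *)
Definition uniformly_superlinear U H : Prop :=
  forall M : R, exists r : R, forall x p, closure U x ->
    r < enorm p -> M <= H x p / enorm p.

Definition admissible_hamiltonian U (K : R) H : Prop :=
  [/\ smooth_closure (U `*` [set: 'rV[R]_n]) (fun z => H z.1 z.2),
      forall x, closure U x -> convex_function setT (H x),
      uniformly_superlinear U H &
      forall x p, closure U x ->
        enorm (grad_closure U (fun y => H y p) x) <= K].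

Definition strict_C1_subsolution U H (Phi : 'rV[R]_n -> R) : Prop :=
  [/\ Ck 2 U Phi,
      Ck_closure 1 U Phi,
      forall x, boundary U x -> Phi x = 0 &
      forall x, closure U x -> Phi x + H x (grad_closure U Phi x) < 0].

(* Viscosity sub- and supersolutions of F(x, u, Du) = 0 in U. *)
Definition viscosity_subsolution U (F : 'rV[R]_n -> R -> 'rV[R]_n -> R)
    (u : 'rV[R]_n -> R) : Prop :=
  forall phi, Ck 1 U phi -> forall x, U x ->
    (\forall y \near x, u y - phi y <= u x - phi x) ->
    F x (u x) (grad phi x) <= 0.

Definition viscosity_supersolution U (F : 'rV[R]_n -> R -> 'rV[R]_n -> R)
    (u : 'rV[R]_n -> R) : Prop :=
  forall phi, Ck 1 U phi -> forall x, U x ->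
    (\forall y \near x, u x - phi x <= u y - phi y) ->
    0 <= F x (u x) (grad phi x).

Definition viscosity_solution U (F : 'rV[R]_n -> R -> 'rV[R]_n -> R)
    (u : 'rV[R]_n -> R) : Prop :=
  viscosity_subsolution U F u /\ viscosity_supersolution U F u.

(* max{u - w - psi, u + H(x, Du)} = 0 for the unknown u, where w is a given
   function. *)
Definition obstacle_operator H (psi w : 'rV[R]_n -> R) :
    'rV[R]_n -> R -> 'rV[R]_n -> R :=
  fun x r p => Num.max (r - w x - psi x) (r + H x p).

Definition obstacle_system_solution U H1 H2
    (psi1 psi2 u1 u2 : 'rV[R]_n -> R) : Prop :=
  [/\ {within closure U, continuous u1} /\ {within closure U, continuous u2},
      viscosity_solution U (obstacle_operator H1 psi1 u2) u1,
      viscosity_solution U (obstacle_operator H2 psi2 u1) u2 &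
      forall x, boundary U x -> u1 x = 0 /\ u2 x = 0].

Definition penalized_system_solution U (gamma : R -> R) H1 H2
    (psi1 psi2 : 'rV[R]_n -> R) (eps : R) (v1 v2 : 'rV[R]_n -> R) : Prop :=
  [/\ smooth_closure U v1 /\ smooth_closure U v2,
      forall x, U x ->
        v1 x + H1 x (grad v1 x)
          + rescaled_penalty gamma eps (v1 x - v2 x - psi1 x)
        = eps * laplacian v1 x,
      forall x, U x ->
        v2 x + H2 x (grad v2 x)
          + rescaled_penalty gamma eps (v2 x - v1 x - psi2 x)
        = eps * laplacian v2 x &
      forall x, boundary U x -> v1 x = 0 /\ v2 x = 0].

(* The L^oo(U) norm of a continuous function on the open set U. *)
Definition Linfty_norm U (f : 'rV[R]_n -> R) : \bar R :=
  ereal_sup [set `|f x|%:E | x in U].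

End hamilton_jacobi.

(* Main.v *)
Require Import Defs.
From mathcomp Require Import all_boot all_order all_algebra.
From mathcomp Require Import all_classical all_reals all_analysis.
From mathcomp Require Import ring lra.

Import Order.TTheory GRing.Theory Num.Theory.
Import numFieldNormedType.Exports.

Local Open Scope classical_set_scope.
Local Open Scope ring_scope.

Set Implicit Arguments.
Unset Strict Implicit.

(** The proof compares the two systems directly by doubling the variables. The
    only regularity it uses is the Lipschitz continuity of the limit [u], which
    comes from the growth of the Hamiltonians.

    Lipschitz bound on [u]. A bounded subsolution of [u + H (x, Du) <= 0] has a
    bounded gradient in the viscosity sense, since [H] is coercive.
    Sup-convolution along segments of [U] turns this into a Lipschitz bound on
    every segment contained in [U] ([lipschitz_segment]). Following a segment to
    the boundary gives [u <= L d], where [d] is the distance to the boundary;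
    the comparison [Phi_le] with the strict subsolutions [Phi], which vanish on
    the boundary, gives [- L d <= u]. Together these yield a Lipschitz bound on
    the closure of [U] ([lipschitz_closure], [limit_lipschitz]). In [Phi_le] both
    obstacles would be active at a point where [Phi - u] has a positive maximum,
    and the sum of the two constraints contradicts [psi1 + psi2 > 0].

    Doubling. Put [del = sqrt eps]. For two families [a] and [b] vanishing on
    the boundary, with [b] Lipschitz, maximize over the index [i] and over [x]
    and [y] in the closure of [U]
      [a i x - b i y - |y - x - t v|^2 / (2 del) - kap |x - xh|^2].
    Here [xh] is a maximum point of [a - b], the vector [v] points into [U] near
    [xh] ([uniformly_inward_exists]), and [t] is a large multiple of [del]. The
    shift by [t v] forces [y] into the interior, where [b] satisfies its
    viscosity inequality; if [x] is on the boundary, then [a i x = 0 = b i x] and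
    the Lipschitz bound on [b] bounds [a - b]. At an interior maximum, [b] is
    touched from below and [a] from above by paraboloids of opening [1 / del]
    whose slopes differ by [O (del)] ([doubling_of_variables]), and the viscous
    term of [a] is [eps * O (1 / del) = O (del)].

    The two estimates. For the upper one, take [a = ue] and [b = (1 + eta) u];
    for the lower one, [a = - ue] and [b = - (1 - eta) u], with [eta] a multiple
    of [del]. By convexity of [H] in the gradient the factor costs only
    [O (eta)] in the equation, whereas [psi >= alpha > 0] makes it create a
    slack of order [eta] in the obstacle. In the upper estimate, if the obstacle
    of [u] is active at [y], maximality over the index gives
    [ue i x - ue j x - psi i x >= del] for the other index [j], hence a
    penalization [gamma s] with [s >= 1 / del], which exceeds the bound that the
    equation of [ue] imposes at [x]: this is where [eps] has to be small. In the
    lower estimate the slack switches the penalization off at [x]. In both cases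
    the two equations compare and give [O (del)]. *)

(** * Directional derivatives of functions of class C^1 *)

Section line.
Context {R : realType} {V : normedModType R}.
Implicit Types (f : V -> R) (x v w : V) (s k : R).

Lemma is_derive_line f x v s : derivable f (x + s *: v) v ->
  is_derive s 1 (fun r => f (x + r *: v)) ('D_v f (x + s *: v)).
Proof.
have E : (fun h : R => h^-1 *: (((fun r => f (x + r *: v)) \o shift s) (h *: 1)
     - f (x + s *: v))) =
   (fun h : R => h^-1 *: ((f \o shift (x + s *: v)) (h *: v) - f (x + s *: v))).
  apply/funext => h /=; congr (_ *: (f _ - _)).
  by rewrite [h *: 1]mulr1 scalerDl addrCA.
by move=> df; split; rewrite /derivable /derive /= E.
Qed.

Lemma is_derive_scale f x v k : derivable f x v ->
  is_derive x (k *: v) f (k * 'D_v f x).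
Proof.
move=> df; have [->|k0] := eqVneq k 0.
  by rewrite scale0r mul0r; exact: is_derive0.
have := @is_derive_line f x v 0; rewrite scale0r addr0 => /(_ df) d1.
have d2 : is_derive (0:R) 1 (fun r : R => k * r) k.
  have := is_deriveZ k (is_derive_id (0:R) (1:R)).
  by rewrite [k *: 1]mulr1.
have d3 : is_derive (0:R) 1 ((fun r => f (x + r *: v)) \o (fun r : R => k * r))
   ('D_v f x * k).
  by apply: is_derive1_comp => //=; rewrite mulr0.
have E : (fun h : R => h^-1 *: ((((fun r => f (x + r *: v)) \o (fun r : R => k * r))
     \o shift 0) (h *: 1) - f x)) =
   (fun h : R => h^-1 *: ((f \o shift x) (h *: (k *: v)) - f x)).
  apply/funext => h /=; congr (_ *: (f _ - _)).
  by rewrite [h *: 1]mulr1 addr0 addrC scalerA mulrC.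
case: d3; rewrite /derivable /derive /= mulr0 scale0r addr0 E => d3 d3'.
by split => //; rewrite /derive d3' mulrC.
Qed.

Lemma line_MVT f x v : (forall s, 0 <= s <= 1 -> derivable f (x + s *: v) v) ->
  exists2 s, 0 <= s <= 1 & f (x + v) - f x = 'D_v f (x + s *: v).
Proof.
move=> df.
have [||s] := @MVT_segment _ (fun r => f (x + r *: v))
  (fun s => 'D_v f (x + s *: v)) 0 1 (ler01).
- move=> s; rewrite in_itv/= => /andP[s0 s1]; apply: is_derive_line.
  by apply: df; rewrite !ltW.
- apply: derivable_within_continuous => s; rewrite in_itv/= => s01.
  by have /df/is_derive_line[] := s01.
rewrite in_itv/= => s01; rewrite scale1r scale0r addr0 subr0 mulr1 => E.
by exists s.
Qed.

Lemma Ck1_derivable (D : set V) f x v : Ck 1 D f -> D x -> derivable f x v.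
Proof. by move=> /(_ [::]) H Dx; case: (H isT x Dx) => _; exact. Qed.

Lemma Ck1_derive_continuous (D : set V) f x v : Ck 1 D f -> D x ->
  {for x, continuous ('D_v f)}.
Proof. by move=> /(_ [:: v]) H Dx; case: (H isT x Dx). Qed.

Lemma Ck_continuous (k : nat) (D : set V) f x : Ck k D f -> D x -> {for x, continuous f}.
Proof. by move=> /(_ [::]) H Dx; case: (H isT x Dx). Qed.

Lemma Ck_derivative (k : nat) (D : set V) f v : Ck k.+1 D f -> Ck k D ('D_v f).
Proof.
move=> H vs vsk x Dx.
have E : iter_derive vs ('D_v f) = iter_derive (rcons vs v) f.
  by rewrite /iter_derive foldr_rcons.
have [] := H (rcons vs v) _ x Dx; rewrite ?size_rcons// -E => c d; split => //.
Qed.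

Lemma Ck_le (k l : nat) (D : set V) f : (k <= l)%N -> Ck l D f -> Ck k D f.
Proof.
move=> kl H vs vk x Dx; have [c d] := H vs (leq_trans vk kl) x Dx.
by split => // vk'; apply: d; exact: leq_trans kl.
Qed.

(** The quotient defining the derivative along [v + w] splits into one along
    [w] at [x] and one along [v] at the nearby point [x + h w], which the mean
    value theorem turns into a derivative at a point close to [x]. *)
Lemma C1_deriveD (D : set V) f x v w : open D -> Ck 1 D f -> D x ->
  'D_(v + w) f x = 'D_v f x + 'D_w f x.
Proof.
move=> oD Cf Dx.
suff H : h^-1 *: ((f \o shift x) (h *: (v + w)) - f x) @[h --> 0^'] -->
         'D_v f x + 'D_w f x by exact/cvg_lim.
have H1 : h^-1 *: ((f \o shift x) (h *: w) - f x) @[h --> 0^'] --> 'D_w f x.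
  by have := Ck1_derivable (v:=w) Cf Dx.
suff H2 : h^-1 *: (f (x + h *: w + h *: v) - f (x + h *: w)) @[h --> 0^'] -->
   'D_v f x.
  rewrite (_ : (fun h => _) = (fun h : R =>
    h^-1 *: (f (x + h *: w + h *: v) - f (x + h *: w)) +
    h^-1 *: ((f \o shift x) (h *: w) - f x))); first exact: cvgD H2 H1.
  apply/funext => h /=; rewrite -scalerDr; congr (_ *: _).
  rewrite [h *: w + x]addrC subrKA scalerDr.
  by congr (f _ - _); rewrite addrC [h *: v + _]addrC addrA.
apply/cvgrPdist_lt => e e0.
have /cvgrPdist_lt/(_ e e0) c := Ck1_derive_continuous (v:=v) Cf Dx.
have /nbhs_ballP[r r0 rP] : \forall y \near x,
    D y /\ `|'D_v f x - 'D_v f y| < e.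
  by near=> y; split; near: y; [exact: open_nbhs_nbhs|exact: c].
pose M := `|v| + `|w| + 1.
have M0 : 0 < M by rewrite ltr_wpDl// addr_ge0.
near=> h.
have h0 : h != 0 by near: h; exact: nbhs_dnbhs_neq.
have hr : `|h| < r / M.
  by near: h; apply: dnbhs0_lt; exact: divr_gt0.
have P s : 0 <= s <= 1 -> D (x + h *: w + s *: (h *: v)) /\
    `|'D_v f x - 'D_v f (x + h *: w + s *: (h *: v))| < e.
  move=> /andP[s0 s1]; apply: rP; rewrite -ball_normE /ball_/= -addrA opprD addrA subrr.
  rewrite sub0r normrN (le_lt_trans (ler_normD _ _))//.
  rewrite !normrZ (ger0_norm s0).
  apply: (@le_lt_trans _ _ (`|h| * M)); last by rewrite -ltr_pdivlMr.
  have A : s * (`|h| * `|v|) <= `|h| * `|v| by rewrite ler_piMl ?mulr_ge0.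
  by have B : 0 <= `|h| by []; rewrite /M; lra.
have [s /P[Ds _]|s s01 E] := @line_MVT f (x + h *: w) (h *: v).
  by have [] := is_derive_scale h (Ck1_derivable (v:=v) Cf Ds).
have [Ds es] := P s s01.
have [_ E'] := is_derive_scale h (Ck1_derivable (v:=v) Cf Ds).
by rewrite E E' [_ *: _]mulrA mulVf// mul1r.
Unshelve. all: by end_near. Qed.

End line.

Section rowvec.
Context {R : realType} {n : nat}.
Implicit Types (f : 'rV[R]_n -> R) (x v w : 'rV[R]_n).

Lemma coord_le_norm x i : `|x 0 i| <= `|x|.
Proof.
rewrite [leRHS]mx_normrE.
by apply/bigmax_geP; right; exists (0, i).
Qed.

Lemma norm_le_coord x (M : R) : 0 <= M -> (forall i, `|x 0 i| <= M) -> `|x| <= M.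
Proof.
move=> M0 H; rewrite [leLHS]mx_normrE; apply/bigmax_leP; split => //= -[i j] _ /=.
by rewrite ord1.
Qed.

Lemma C1_derive_sum (D : set 'rV[R]_n) f x v : open D -> Ck 1 D f -> D x ->
  'D_v f x = \sum_(i < n) v 0 i * partial i f x.
Proof.
move=> oD Cf Dx; rewrite {1}(row_sum_delta v).
elim/big_ind2 : _ => [|w a w' b E E'|i _].
- exact: derive0.
- by rewrite (C1_deriveD _ _ oD Cf Dx) E E'.
- by have [_ ->] := is_derive_scale (v 0 i) (Ck1_derivable (v:=delta_mx 0 i) Cf Dx).
Qed.

Lemma C1_lipschitz_segment (D : set 'rV[R]_n) f (M : R) x y : open D -> Ck 1 D f ->
  (forall s, 0 <= s <= 1 -> D (x + s *: (y - x))) ->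
  (forall s i, 0 <= s <= 1 -> `|partial i f (x + s *: (y - x))| <= M) ->
  `|f y - f x| <= n%:R * M * `|y - x|.
Proof.
move=> oD Cf DP MP.
have [s /DP Ds|s s01] := @line_MVT _ _ f x (y - x); first exact: Ck1_derivable Cf Ds.
rewrite [x + _]addrC subrK => ->; rewrite (C1_derive_sum _ oD Cf (DP s s01)).
rewrite (le_trans (ler_norm_sum _ _ _))//.
have -> : n%:R * M * `|y - x| = \sum_(i < n) (`|y - x| * M).
  by rewrite sumr_const card_ord -mulrA mulr_natl mulrC.
by apply: ler_sum => i _; rewrite normrM ler_pM ?coord_le_norm// MP.
Qed.

End rowvec.

(** * Touching paraboloids *)

(** If [h1 0 = al] but [c > 2 be], then [h1] exceeds the derivative of the
    parabola just to the right of [0], and [h] crosses it there. *)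
Lemma second_order_touch (R : realType) (h h1 : R -> R) (c r al be : R) : 0 < r ->
  (forall s, `|s| < r -> is_derive s (1 : R) h (h1 s)) -> is_derive 0 (1 : R) h1 c ->
  (forall s, `|s| < r -> h s <= h 0 + al * s + be * s ^+ 2) ->
  h1 0 = al /\ c <= 2 * be.
Proof.
move=> r0 dh dh1 hle.
pose k := h - (al *: (id : R -> R) + be *: ((id : R -> R) ^+ 2)).
pose k1 := h1 - (cst al + (2 * be) *: (id : R -> R)).
have dk s : `|s| < r -> is_derive s (1 : R) k (k1 s).
  move=> /dh dhs; have dal := is_deriveZ al (is_derive_id s (1 : R)).
  have dbe := is_deriveZ be (is_deriveX 2 (is_derive_id s (1 : R))).
  apply: is_derive_eq (is_deriveB dhs (is_deriveD dal dbe)) _.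
  by rewrite /k1 !fctE /= expr1 /GRing.scale/= !mulr1; ring.
have dk1 : is_derive 0 (1 : R) k1 (c - 2 * be).
  have dbe := is_deriveZ (2 * be) (is_derive_id 0 (1 : R)).
  apply: is_derive_eq (is_deriveB dh1 (is_deriveD (is_derive_cst al 0 (1 : R)) dbe)) _.
  by rewrite /GRing.scale/= !mulr1 add0r.
have rE s : (s \in `]- r, r[) = (`|s| < r) by rewrite in_itv/= ltr_norml.
have kmax s : `|s| < r -> k s <= k 0.
  move=> /hle; rewrite /k /= !fctE /= /GRing.scale/= expr0n/= !mulr0 addr0 subr0.
  lra.
have rr : - r <= r by lra.
have n0 : `|0 : R| < r by rewrite normr0.
have dk0 : is_derive (0 : R) (1 : R) k 0.
  apply: (derive1_at_max rr).
  - by move=> t; rewrite rE => /dk[].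
  - by rewrite rE.
  - by move=> t; rewrite rE; exact: kmax.
have k10 : k1 0 = 0 by have [_ <-] := dk 0 n0; have [] := dk0.
split.
  by move: k10; rewrite /k1 !fctE /= scaler0 addr0 => /eqP; rewrite subr_eq0 => /eqP.
rewrite -subr_le0 leNgt; apply/negP => c0.
have [dc dE] := dk1.
have : h^-1 *: ((k1 \o shift 0) (h *: 1) - k1 0) @[h --> 0^'] --> c - 2 * be.
  by rewrite -dE; exact: dc.
move=> /cvgr_gt/(_ 0 c0).
rewrite -[X in X -> _]/(\forall h \near 0^', _) near_withinE.
move=> /nbhs_ballP[r' /= r'0 P].
pose s := Num.min r r' / 2.
have m0 : 0 < Num.min r r' by rewrite lt_min r0.
have s0 : 0 < s by rewrite divr_gt0.
have [sr sr'] : s < r /\ s < r'.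
  have : s < Num.min r r' by rewrite /s; lra.
  by rewrite lt_min => /andP.
have k1_gt0 t : t \in `]0, s[%R -> 0 < k1 t.
  rewrite in_itv/= => /andP[t0 ts]; have := P t.
  rewrite /ball/= sub0r normrN gtr0_norm// (lt_trans ts)// => /(_ isT).
  rewrite gt_eqF// => /(_ isT).
  by rewrite /= k10 subr0 addr0 [t *: 1]mulr1 pmulr_rgt0 ?invr_gt0.
have ab t : 0 <= t <= s -> `|t| < r.
  by move=> /andP[t0 ts]; rewrite ger0_norm// (le_lt_trans ts).
have [||t ts] := @MVT _ k k1 0 s s0.
- move=> t; rewrite in_itv/= => /andP[t0 ts]; apply: dk; apply: ab.
  by rewrite !ltW.
- apply: derivable_within_continuous => t; rewrite in_itv/= => /ab/dk.
  by case.
rewrite subr0 => E; have : 0 < k s - k 0 by rewrite E mulr_gt0// k1_gt0.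
by rewrite subr_gt0 ltNge kmax// ab// ltW// lexx.
Qed.

Section quadratic.
Context {R : realType} {n : nat}.
Implicit Types (x y z v c : 'rV[R]_n) (k : R).

(** The norm of ['rV[R]_n] is the sup norm, which is not differentiable; the
    test functions are built from the squared Euclidean norm [sqn]. *)
Definition dot x y : R := \sum_(i < n) x 0 i * y 0 i.
Definition sqn x : R := dot x x.

Lemma dotC x y : dot x y = dot y x.
Proof. by apply: eq_bigr => i _; rewrite mulrC. Qed.

Lemma dotDl x y z : dot (x + y) z = dot x z + dot y z.
Proof. by rewrite -big_split; apply: eq_bigr => i _; rewrite mxE mulrDl. Qed.

Lemma dotZl k x z : dot (k *: x) z = k * dot x z.
Proof. by rewrite mulr_sumr; apply: eq_bigr => i _; rewrite mxE mulrA. Qed.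

Lemma dotDr x y z : dot z (x + y) = dot z x + dot z y.
Proof. by rewrite !(dotC z) dotDl. Qed.

Lemma dotZr k x z : dot z (k *: x) = k * dot z x.
Proof. by rewrite !(dotC z) dotZl. Qed.

Lemma dot_delta x j : dot x (delta_mx 0 j) = x 0 j.
Proof.
rewrite /dot (bigD1 j)//= mxE !eqxx mulr1 big1 ?addr0// => i /negbTE ij.
by rewrite mxE ij andbF mulr0.
Qed.

Lemma sqnD x y : sqn (x + y) = sqn x + 2 * dot x y + sqn y.
Proof. by rewrite /sqn dotDl !dotDr (dotC y x); ring. Qed.

Lemma sqnZ k x : sqn (k *: x) = k ^+ 2 * sqn x.
Proof. by rewrite /sqn dotZl dotZr mulrA. Qed.

Lemma sqn_ge0 x : 0 <= sqn x.
Proof. by apply: sumr_ge0 => i _; rewrite -expr2 sqr_ge0. Qed.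

Lemma sqn0 : sqn (0 : 'rV[R]_n) = 0.
Proof. by rewrite /sqn /dot big1// => i _; rewrite mxE mul0r. Qed.

Lemma sqn_delta j : sqn (delta_mx 0 j) = 1.
Proof. by rewrite /sqn dot_delta mxE !eqxx. Qed.

Lemma norm_sqr_le_sqn x : `|x| ^+ 2 <= sqn x.
Proof.
have s0 := sqn_ge0 x.
rewrite -(sqr_sqrtr s0) ler_sqr ?nnegrE ?sqrtr_ge0//.
apply: norm_le_coord => [|i]; first exact: sqrtr_ge0.
rewrite -sqrtr_sqr ler_sqrt// /sqn /dot (bigD1 i)//= -expr2 lerDl.
by apply: sumr_ge0 => j _; rewrite -expr2 sqr_ge0.
Qed.

Lemma norm_dot_le x y : `|dot x y| <= n%:R * (`|x| * `|y|).
Proof.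
rewrite (le_trans (ler_norm_sum _ _ _))//.
have -> : n%:R * (`|x| * `|y|) = \sum_(i < n) (`|x| * `|y|).
  by rewrite sumr_const card_ord mulr_natl.
by apply: ler_sum => i _; rewrite normrM ler_pM// coord_le_norm.
Qed.

Lemma sqn_le x : sqn x <= n%:R * `|x| ^+ 2.
Proof. by rewrite (le_trans (ler_norm _))// norm_dot_le. Qed.

Lemma shift_coord_continuous c i :
  continuous (fun x : 'rV[R]_n => (x - c) 0 i).
Proof.
have -> : (fun x : 'rV[R]_n => (x - c) 0 i) = (fun x => x 0 i - c 0 i).
  by apply/funext => x; rewrite !mxE.
move=> y; apply: continuousB; [exact: coord_continuous|exact: cst_continuous].
Qed.

Lemma dot_continuous v c : continuous (fun y => dot v (y - c)).
Proof.
apply: (continuous_big (op := +%R)) => [|i _ y]; first exact: add_continuous.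
apply: (@continuousM _ _ (cst (v 0 i)) (fun x => (x - c) 0 i)).
  exact: cst_continuous.
exact: shift_coord_continuous.
Qed.

Lemma sqn_continuous c : continuous (fun y => sqn (y - c)).
Proof.
apply: (continuous_big (op := +%R)) => [|i _ y]; first exact: add_continuous.
by apply: (@continuousM _ _ (fun x => (x - c) 0 i) (fun x => (x - c) 0 i));
  exact: shift_coord_continuous.
Qed.

Lemma is_derive_sqn k c v y :
  is_derive y v (fun x => k * sqn (x - c)) (2 * k * dot v (y - c)).
Proof.
suff H : h^-1 *: (((fun x => k * sqn (x - c)) \o shift y) (h *: v)
     - k * sqn (y - c)) @[h --> 0^'] --> 2 * k * dot v (y - c).
  split; last exact/cvg_lim.
  by apply/cvg_ex; eexists; exact: H.
have : 2 * k * dot v (y - c) + h * (k * sqn v) @[h --> (0 : R)^']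
   --> 2 * k * dot v (y - c) + 0 * (k * sqn v).
  apply: cvgD; first exact: cvg_cst.
  by apply: cvgMr_tmp; exact: nbhs_dnbhs.
rewrite mul0r addr0; apply: cvg_trans; apply: near_eq_cvg; near=> h.
have h0 : h != 0 by near: h; exact: nbhs_dnbhs_neq.
rewrite /= -[h *: v + y - c]addrA [sqn (h *: v + _)]sqnD sqnZ dotZl /GRing.scale/=.
by field.
Unshelve. all: by end_near. Qed.

Lemma Ck1_sqn (D : set 'rV[R]_n) k c : Ck 1 D (fun x => k * sqn (x - c)).
Proof.
move=> [|v [|]]// _ x _; split => //=.
- apply: (@continuousM _ _ (cst k) (fun x => sqn (x - c))).
    exact: cst_continuous.
  exact: sqn_continuous.
- by move=> _ v; have [] := is_derive_sqn k c v x.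
have -> : 'D_v (fun x => k * sqn (x - c)) = fun y => 2 * k * dot v (y - c).
  by apply/funext => y; have [_ ->] := is_derive_sqn k c v y.
apply: (@continuousM _ _ (cst (2 * k)) (fun x => dot v (x - c))).
  exact: cst_continuous.
exact: dot_continuous.
Qed.

Lemma scaled_sqn_continuous k c : continuous (fun y => k * sqn (y - c)).
Proof. by move=> y; apply: (Ck_continuous (Ck1_sqn (D := setT) k c)). Qed.

Lemma grad_sqn k c y : grad (fun x => k * sqn (x - c)) y = (2 * k) *: (y - c).
Proof.
apply/rowP => i; rewrite !mxE /partial.
by have [_ ->] := is_derive_sqn k c (delta_mx 0 i) y; rewrite dotC dot_delta !mxE.
Qed.

End quadratic.

Section touch.
Context {R : realType} {n : nat}.
Implicit Types (f : 'rV[R]_n -> R) (x p : 'rV[R]_n) (D : set 'rV[R]_n).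

Lemma nbhs_line D x v : open D -> D x ->
  exists2 r : R, 0 < r & forall s, `|s| < r -> D (x + s *: v).
Proof.
move=> oD Dx; have /nbhs_ballP[e /= e0 eD] := open_nbhs_nbhs (conj oD Dx).
exists (e / (`|v| + 1)); first by rewrite divr_gt0// ltr_wpDl.
move=> s se; apply: eD; rewrite -ball_normE /ball_/= opprD addrA subrr sub0r normrN.
rewrite normrZ; move: se; rewrite ltr_pdivlMr ?ltr_wpDl//; apply: le_lt_trans.
by rewrite mulrDr mulr1 lerDl.
Qed.

Lemma partial_is_derive_line D f x j s : Ck 1 D f -> D (x + s *: delta_mx 0 j) ->
  is_derive s (1 : R) (fun r => f (x + r *: delta_mx 0 j))
    (partial j f (x + s *: delta_mx 0 j)).
Proof. by move=> Cf Ds; apply: is_derive_line; exact: Ck1_derivable Cf Ds. Qed.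

(** Touching is only assumed along the coordinate axes: this is all that the
    gradient and the Laplacian see. *)
Lemma touch_above D f x p be : open D -> Ck 2 D f -> D x ->
  (forall j s, D (x + s *: delta_mx 0 j) ->
     f (x + s *: delta_mx 0 j) <= f x + p 0 j * s + be * s ^+ 2) ->
  grad f x = p /\ laplacian f x <= n%:R * (2 * be).
Proof.
move=> oD C2 Dx H.
have C1 : Ck 1 D f by apply: Ck_le C2.
suff P j : partial j f x = p 0 j /\ partial j (partial j f) x <= 2 * be.
  split; first by apply/rowP => j; rewrite mxE; case: (P j).
  have -> : n%:R * (2 * be) = \sum_(i < n) (2 * be).
    by rewrite sumr_const card_ord mulr_natl.
  by apply: ler_sum => j _; case: (P j).
have [r r0 rD] := nbhs_line (delta_mx 0 j) oD Dx.
have := @second_order_touch R (fun s => f (x + s *: delta_mx 0 j))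
  (fun s => partial j f (x + s *: delta_mx 0 j))
  (partial j (partial j f) x) r (p 0 j) be r0.
rewrite scale0r addr0; apply.
- by move=> s /rD; exact: partial_is_derive_line.
- have := @partial_is_derive_line D (partial j f) x j 0.
  by rewrite scale0r addr0; apply => //; exact: Ck_derivative.
- by move=> s /rD /H.
Qed.

Lemma touch_below D f x p be : open D -> Ck 2 D f -> D x ->
  (forall j s, D (x + s *: delta_mx 0 j) ->
     f x + p 0 j * s + be * s ^+ 2 <= f (x + s *: delta_mx 0 j)) ->
  grad f x = p /\ n%:R * (2 * be) <= laplacian f x.
Proof.
move=> oD C2 Dx H.
have C1 : Ck 1 D f by apply: Ck_le C2.
suff P j : partial j f x = p 0 j /\ 2 * be <= partial j (partial j f) x.
  split; first by apply/rowP => j; rewrite mxE; case: (P j).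
  have -> : n%:R * (2 * be) = \sum_(i < n) (2 * be).
    by rewrite sumr_const card_ord mulr_natl.
  by apply: ler_sum => j _; case: (P j).
have [r r0 rD] := nbhs_line (delta_mx 0 j) oD Dx.
have [|||] := @second_order_touch R (- (fun s => f (x + s *: delta_mx 0 j)))
  (- (fun s => partial j f (x + s *: delta_mx 0 j)))
  (- partial j (partial j f) x) r (- p 0 j) (- be) r0.
- by move=> s /rD Ds; apply: is_deriveN; exact: partial_is_derive_line Ds.
- apply: is_deriveN; have := @partial_is_derive_line D (partial j f) x j 0.
  by rewrite scale0r addr0; apply => //; exact: Ck_derivative.
- by move=> s /rD /H; rewrite !fctE scale0r addr0; lra.
- by rewrite !fctE scale0r addr0 => A1 A2; split; lra.
Qed.

End touch.

(** * Bounds from compactness *)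

Section compactness.
Context {R : realType}.

Lemma bounded_on_compact (T : topologicalType) (A : set T) (f : T -> R) :
  compact A -> {within A, continuous f} ->
  exists2 B, 0 <= B & forall x, A x -> `|f x| <= B.
Proof.
move=> cA cf; have [A0|A0] := pselect (A !=set0); last first.
  by exists 0 => // x Ax; exfalso; apply: A0; exists x.
have [|c _ Hc] := @compact_EVT_max _ R (fun x => `|f x|) A A0 cA.
  by move=> z; apply: continuous_comp; [exact: cf|exact: norm_continuous].
by exists `|f c| => // x Ax; apply: Hc; rewrite inE.
Qed.

(** For functions, such as the derivatives of [f] in [Ck_closure 1 U f], whose
    values outside [U] are meaningless. *)
Lemma bounded_within (T : topologicalType) (U : set T) (g : T -> R) :
  compact (closure U) ->
  (forall x, closure U x -> cvg (g y @[y --> within U (nbhs x)])) ->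
  exists2 M, 0 <= M & forall y, U y -> `|g y| <= M.
Proof.
move=> /compact_near_coveringP cU H.
have [x Ux|] := cU R (pinfty_nbhs R) (fun M y => U y -> `|g y| <= M) _.
  have /cvg_norm/cvgr_lt/(_ (`|lim (g y @[y --> within U (nbhs x)])| + 1)) := H x Ux.
  rewrite ltrDl => /(_ ltr01) A.
  exists ([set y | U y -> `|g y| < `|lim (g y @[y --> within U (nbhs x)])| + 1],
    [set M | `|lim (g y @[y --> within U (nbhs x)])| + 1 < M]).
    by split; [exact: A | apply: nbhs_pinfty_gt; exact: num_real].
  by move=> [y M] /= [A1 A2] /A1 /lt_trans/(_ A2)/ltW.
move=> M [_ HM].
have M1 : M < `|M| + 1 by rewrite (le_lt_trans (ler_norm _))// ltrDl.
exists (`|M| + 1); first by rewrite addr_ge0.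
by move=> y Uy; apply: (HM _ M1) => //; exact: subset_closure.
Qed.

Lemma forall_bound (n : nat) (P : 'I_n -> R -> Prop) :
  (forall i (a b : R), a <= b -> P i a -> P i b) ->
  (forall i, exists2 M : R, 0 <= M & P i M) ->
  exists2 M : R, 0 <= M & forall i, P i M.
Proof.
move=> mP H.
have /choice[M HM] : forall i, exists M, 0 <= M /\ P i M.
  by move=> i; have [M ? ?] := H i; exists M.
exists (\sum_i M i); first by apply: sumr_ge0 => i _; case: (HM i).
move=> i; apply: (mP i (M i)); last by case: (HM i).
by rewrite (bigD1 i)//= lerDl; apply: sumr_ge0 => j _; case: (HM j).
Qed.

Lemma Ck_closure_partial_bounded n (U : set 'rV[R]_n) f :
  compact (closure U) -> Ck_closure 1 U f ->
  exists2 M, 0 <= M & forall x i, U x -> `|partial i f x| <= M.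
Proof.
move=> cU [_ _ H].
have [||M M0 HM] := @forall_bound n (fun i M => forall x, U x -> `|partial i f x| <= M).
- by move=> i a b ab Ha x /Ha /le_trans; exact.
- move=> i; apply: bounded_within => // x Ux.
  exact: (H [:: delta_mx 0 i]).
- by exists M => // x i; exact: HM.
Qed.

Lemma closed_ball_compact n (z : 'rV[R]_n) r : compact [set y | `|y - z| <= r].
Proof.
apply: bounded_closed_compact.
- exists (`|z| + r); split; first exact: num_real.
  move=> M HM y /= yz; rewrite -(subrK z y) (le_trans (ler_normD _ _))//.
  by rewrite (le_trans _ (ltW HM))// addrC lerD2l.
- have -> : [set y | `|y - z| <= r] = (fun y => `|y - z|) @^-1` [set x | x <= r] by [].
  apply: closed_comp; last exact: closed_le.
  move=> y _; apply: continuous_comp; last exact: norm_continuous.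
  by apply: continuousB => //; exact: cst_continuous.
Qed.

End compactness.

(** * From gradient bounds to Lipschitz bounds along segments *)

Definition segment_in (R : realType) (n : nat) (U : set 'rV[R]_n) (x y : 'rV[R]_n) :=
  forall s, 0 <= s <= 1 -> U (x + s *: (y - x)).

Lemma le_of_forall_add_mul (R : realType) (x y c : R) :
  (forall e, 0 < e -> x <= y + e * c) -> x <= y.
Proof.
move=> H; apply/ler_addgt0Pr => e e0.
have c1 : 0 < `|c| + 1 by rewrite ltr_wpDl.
have := H (e / (`|c| + 1)) (divr_gt0 e0 c1) => /le_trans; apply.
rewrite lerD2l -mulrA ger_pMr// ler_pdivrMl// mulr1.
by rewrite (le_trans (ler_norm _))// lerDl.
Qed.

(** Over [N] pieces of length [1 / N] the quadratic errors add up to [b / N]. *)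
Lemma subdivide (R : realType) (W : R -> R) (a b eta : R) : 0 < eta ->
  (forall s s', 0 <= s <= 1 -> 0 <= s' <= 1 -> `|s - s'| <= eta ->
     W s - W s' <= a * `|s - s'| + b * `|s - s'| ^+ 2) ->
  W 0 - W 1 <= a.
Proof.
move=> eta0 H; apply: (@le_of_forall_add_mul _ _ _ `|b|) => e e0.
pose m := Num.min e eta.
have m0 : 0 < m by rewrite lt_min e0.
pose N := (Num.truncn m^-1).+1.
have N0 : 0 < N%:R :> R by rewrite ltr0n.
have Nm : N%:R^-1 < m.
  rewrite -[m]invrK ltf_pV2 ?posrE ?invr_gt0//.
  exact: Num.Theory.truncnS_gt.
have step i : (i < N)%N ->
    W (i%:R / N%:R) - W (i.+1%:R / N%:R) <= a / N%:R + `|b| * e / N%:R.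
  move=> iN.
  have D : `|i%:R / N%:R - i.+1%:R / N%:R| = N%:R^-1 :> R.
    by rewrite -mulrBl -natr1 opprD addrA subrr sub0r mulN1r normrN ger0_norm ?invr_ge0// ltW.
  have I k : (k <= N)%N -> 0 <= (k%:R / N%:R : R) <= 1.
    by move=> kN; rewrite divr_ge0//= ler_pdivrMr// mul1r ler_nat.
  have := H _ _ (I i (ltnW iN)) (I i.+1 iN).
  rewrite D => /(_ _)/le_trans; apply.
    by rewrite (le_trans (ltW Nm))// /m ge_min lexx orbT.
  rewrite lerD2l (@le_trans _ _ (`|b| * N%:R^-1 ^+ 2))//.
    by rewrite ler_wpM2r ?ler_norm// exprn_ge0// invr_ge0 ltW.
  rewrite expr2 mulrA ler_wpM2r// ?invr_ge0 ?(ltW N0)// ler_wpM2l//.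
  by rewrite (le_trans (ltW Nm))// /m ge_min lexx.
have -> : W 0 - W 1 =
    \sum_(0 <= i < N) (W (i%:R / N%:R) - W (i.+1%:R / N%:R)).
  rewrite (eq_bigr (fun i => - W (i.+1%:R / N%:R) - - W (i%:R / N%:R))).
    rewrite (telescope_sumr (fun i => - W (i%:R / N%:R)))//.
    by rewrite mul0r divff ?gt_eqF// addrC opprK.
  by move=> i _; rewrite addrC opprK.
rewrite big_mkord (@le_trans _ _ (\sum_(i < N) (a / N%:R + `|b| * e / N%:R)))//.
  by apply: ler_sum => i _; exact: step.
rewrite sumr_const card_ord -[leLHS]mulr_natr -[X in X * _ <= _]mulrDl divfK ?gt_eqF//.
by rewrite lerD2l mulrC.
Qed.

Section supconv.
Context {R : realType} {n : nat}.
Variables (U : set 'rV[R]_n) (w : 'rV[R]_n -> R) (B R0 : R).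
Hypotheses (oU : open U) (cw : forall x, U x -> {for x, continuous w})
  (B0 : 0 <= B) (wB : forall x, U x -> `|w x| <= B) (R00 : 0 <= R0)
  (wR : forall c k z, 0 < k -> U z ->
     (\forall y \near z, w y - k * sqn (y - c) <= w z - k * sqn (z - c)) ->
     `|(2 * k) *: (z - c)| <= R0).

(** Segments are compact, so one in [U] stays at a positive distance from the
    complement of [U]. *)
Lemma seg_tube x y : segment_in U x y ->
  exists2 r : R, 0 < r &
    forall s z, 0 <= s <= 1 -> `|z - (x + s *: (y - x))| <= r -> U z.
Proof.
move=> S.
have /compact_near_coveringP cI := @segment_compact R 0 1.
pose P r s := forall z, `|z - (x + s *: (y - x))| <= r -> U z.
suff A (s : R) : `[0, 1]%classic s -> \forall s' \near s & r \near 0^'+, P r s'.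
  have A1 : \forall r \near (0 : R)^'+, 0 < r /\ `[0, 1] `<=` P r.
    have A2 := cI R (at_right (0 : R)) P (at_right_proper_filter (0 : R)) A.
    exact: (filterI (nbhs_right_gt (0 : R)) A2).
  have [r [r0 rP]] := filter_ex A1.
  by exists r => // s z s01; apply: rP; rewrite /= in_itv.
move=> s01.
have /S Us : 0 <= s <= 1 by move: s01; rewrite /= in_itv.
have /nbhs_ballP[e /= e0 eU] := open_nbhs_nbhs (conj oU Us).
have M0 : 0 < `|y - x| + 1 by rewrite ltr_wpDl.
have e20 : 0 < e / 2 by rewrite divr_gt0.
exists ([set s' | `|s' - s| < e / 2 / (`|y - x| + 1)], [set r | r < e / 2]).
  split => /=.
    by apply/nbhs_ballP; exists (e / 2 / (`|y - x| + 1)) => /=;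
      [rewrite !divr_gt0|move=> t; rewrite -ball_normE /ball_/= distrC].
  exact: (nbhs_right_lt e20).
move=> [s' r] /= [s's re] z zr; apply: eU; rewrite -ball_normE /ball_/= distrC.
have -> : z - (x + s *: (y - x)) = (z - (x + s' *: (y - x))) + (s' - s) *: (y - x).
  by rewrite scalerBl !opprD !addrA subrK.
rewrite (le_lt_trans (ler_normD _ _))// normrZ.
have : `|s' - s| * `|y - x| <= e / 2.
  move: s's; rewrite ltr_pdivlMr// => /ltW; apply: le_trans.
  by rewrite mulrDr mulr1 lerDl.
by move: zr; lra.
Qed.

(** The penalization beats the oscillation of [w] on the sphere of radius [r],
    so the maximum defining the sup-convolution at [z] is attained inside the
    ball, where [wR] bounds the slope of the paraboloid. *)
Lemma supconv_max z k r : 0 < k -> 0 < r -> 2 * B < k * r ^+ 2 ->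
  (forall y, `|y - z| <= r -> U y) ->
  exists y, [/\ `|y - z| <= r, `|(2 * k) *: (y - z)| <= R0 &
    forall y', `|y' - z| <= r -> w y' - k * sqn (y' - z) <= w y - k * sqn (y - z)].
Proof.
move=> k0 r0 kr KU.
have [||y] := @EVT_max_rV R n (fun y => w y - k * sqn (y - z))
  [set y | `|y - z| <= r] _ (@closed_ball_compact R n z r).
- by exists z; rewrite /= subrr normr0 ltW.
- apply: continuous_in_subspaceT => y' /[1!inE] /= y'r.
  apply: (@continuousB _ _ _ w (fun y => k * sqn (y - z))); first exact/cw/KU.
  exact: (scaled_sqn_continuous (k := k) (c := z)).
rewrite inE => /= yr H; exists y.
have Hy y' : `|y' - z| <= r -> w y' - k * sqn (y' - z) <= w y - k * sqn (y - z).
  by move=> y'r; apply: H; rewrite inE.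
split => //; apply: wR => //; first exact: KU.
have yr' : `|y - z| < r.
  rewrite ltNge; apply/negP => ry.
  have := Hy z; rewrite subrr normr0 sqn0 (ltW r0) => /(_ isT) A.
  have : k * r ^+ 2 <= k * sqn (y - z).
    rewrite ler_wpM2l ?(ltW k0)// (le_trans _ (norm_sqr_le_sqn _))//.
    by rewrite ler_sqr// nnegrE// ltW.
  have := wB (KU y yr); have : `|w z| <= B by apply: wB; apply: KU; rewrite subrr normr0 ltW.
  rewrite !ler_norml => /andP[? ?] /andP[? ?]; lra.
apply/nbhs_ballP; exists (r - `|y - z|); first by rewrite /= subr_gt0.
move=> y'; rewrite -ball_normE /ball_/= distrC ltrBrDr => y'r; apply: Hy.
by rewrite -(subrK y y') -addrA (le_trans (ler_normD _ _))// ltW.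
Qed.

(** Let [W s] be the sup-convolution of [w] at the point [ga s] of the segment
    and [Y s] a point realizing it. Using [Y s] as a competitor at [ga s']
    bounds [W s - W s'] by the scalar product of the slope [2 k (Y s - ga s)],
    of norm at most [R0], with [ga s - ga s'], up to a quadratic error that
    [subdivide] removes. As [k] grows, [W] tends to [w]. *)
Lemma lipschitz_segment x y : segment_in U x y -> w x - w y <= n%:R * R0 * `|y - x|.
Proof.
move=> S; have [r r0 rU] := seg_tube S.
pose ga s := x + s *: (y - x).
have ga0 : ga 0 = x by rewrite /ga scale0r addr0.
have ga1 : ga 1 = y by rewrite /ga scale1r addrC subrK.
have Uy : U y by rewrite -ga1; apply: S; rewrite ler01 lexx.
have Ux : U x by rewrite -ga0; apply: S; rewrite ler01 lexx.
apply/ler_addgt0Pl => e e0.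
have /cvgrPdist_lt/(_ e e0)/nbhs_ballP[d /= d0 dP] := cw Uy.
have [k [k0 kr kr' kd]] : exists k, [/\ 0 < k, 2 * B < k * r ^+ 2, R0 < k * r & R0 < k * d].
  have r2 : 0 < r ^+ 2 by rewrite exprn_gt0.
  have a1 : 0 <= 2 * B / r ^+ 2 by rewrite divr_ge0 ?mulr_ge0// ltW.
  have a2 : 0 <= R0 / r by rewrite divr_ge0// ltW.
  have a3 : 0 <= R0 / d by rewrite divr_ge0// ltW.
  exists (2 * B / r ^+ 2 + R0 / r + R0 / d + 1).
  by split; rewrite -?ltr_pdivrMr//; lra.
have /choice[Y HY] : forall s, exists Ys, 0 <= s <= 1 ->
   [/\ `|Ys - ga s| <= r, `|(2 * k) *: (Ys - ga s)| <= R0 &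
    forall y', `|y' - ga s| <= r ->
      w y' - k * sqn (y' - ga s) <= w Ys - k * sqn (Ys - ga s)].
  move=> s; have [s01|s01] := boolP (0 <= s <= 1); last by exists 0.
  have [Ys HYs] := supconv_max k0 r0 kr (rU s ^~ s01).
  by exists Ys.
pose W s := w (Y s) - k * sqn (Y s - ga s).
have Y2 s : 0 <= s <= 1 -> 2 * k * `|Y s - ga s| <= R0.
  by move=> /HY[_ + _]; rewrite normrZ gtr0_norm// mulr_gt0.
have W0 : w x <= W 0.
  rewrite /W; have [|_ _ /(_ x)] := HY 0; first by rewrite lexx ler01.
  by rewrite ga0 subrr normr0 sqn0 mulr0 subr0; apply; exact: ltW.
have W1 : W 1 <= w y + e.
  have := Y2 1; rewrite lexx ler01 => /(_ isT) Yd.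
  have : `|w y - w (Y 1)| < e.
    apply: dP; rewrite -ball_normE /ball_/= distrC -ga1.
    rewrite -(ltr_pM2l k0) (le_lt_trans _ kd)// (le_trans _ Yd)//.
    by rewrite ler_wpM2r// mulr_natl mulr2n lerDl ltW.
  have : 0 <= k * sqn (Y 1 - ga 1) by rewrite mulr_ge0// ?sqn_ge0// ltW.
  rewrite ltr_norml /W => ? /andP[? ?]; lra.
suff : W 0 - W 1 <= n%:R * R0 * `|y - x| by lra.
pose M := `|y - x| + 1.
have M0 : 0 < M by rewrite ltr_wpDl.
apply: (@subdivide _ W _ (k * n%:R * `|y - x| ^+ 2) (r / 2 / M)).
  by rewrite !divr_gt0.
move=> s s' s01 s'01 ss'.
have gg : ga s - ga s' = (s - s') *: (y - x).
  by rewrite /ga opprD addrACA subrr add0r -scalerBl.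
have ggr : `|ga s - ga s'| <= r / 2.
  rewrite gg normrZ; move: ss'; rewrite ler_pdivlMr//; apply: le_trans.
  by rewrite ler_wpM2l// lerDl.
have Yr : `|Y s - ga s| <= r / 2.
  rewrite -(ler_pM2l k0) -(ler_pM2l (ltr0Sn R 1)) mulrA (le_trans (Y2 _ s01))//.
  by rewrite (_ : 2 * _ = k * r) ?ltW//; field.
have [_ _ /(_ (Y s))] := HY _ s'01.
have E : Y s - ga s' = (Y s - ga s) + (ga s - ga s') by rewrite addrA subrK.
rewrite E (le_trans (ler_normD _ _)) => [/(_ isT)|]; last by lra.
rewrite sqnD -/(W s') /W => A.
have B1 : 2 * k * dot (Y s - ga s) (ga s - ga s') <= n%:R * (R0 * `|ga s - ga s'|).
  rewrite (le_trans (ler_norm _))// normrM gtr0_norm ?mulr_gt0//.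
  rewrite (le_trans (ler_wpM2l _ (norm_dot_le _ _))) ?mulr_ge0 ?(ltW k0)//.
  rewrite mulrCA ler_wpM2l// mulrA ler_wpM2r//; exact: Y2.
have B2 : k * sqn (ga s - ga s') <= k * (n%:R * `|ga s - ga s'| ^+ 2).
  by rewrite ler_wpM2l ?(ltW k0)// sqn_le.
rewrite [leRHS](_ : _ = n%:R * (R0 * `|ga s - ga s'|) + k * (n%:R * `|ga s - ga s'| ^+ 2)).
  lra.
by rewrite gg normrZ; ring.
Qed.

End supconv.

(** * Inward directions and Lipschitz bounds up to the boundary *)

Section inward.
Context {R : realType} {n : nat}.
Implicit Types (U : set 'rV[R]_n) (x z v : 'rV[R]_n).

(** [v] leads from every point of the closure of [U] near [x0] into [U], with
    room for an error of norm one. *)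
Definition inward_within U (r : R) x0 v := forall x t z, closure U x ->
  `|x - x0| < r -> 0 < t < r -> `|z| <= 1 -> U (x + t *: (v + z)).

Lemma C1_locally_lipschitz m (g : 'rV[R]_m -> R) (y0 : 'rV[R]_m) : Ck 1 setT g ->
  exists2 L : R, 0 <= L & forall y y', `|y - y0| <= 1 -> `|y' - y0| <= 1 ->
    `|g y' - g y| <= L * `|y' - y|.
Proof.
move=> Cg.
have [||M M0 HM] := @forall_bound R m
  (fun i M => forall y, `|y - y0| <= 1 -> `|partial i g y| <= M).
- by move=> i a b ab Ha y /Ha /le_trans; exact.
- move=> i; apply: (bounded_on_compact (@closed_ball_compact R m y0 1)).
  apply: continuous_subspaceT => y.
  exact: (Ck1_derive_continuous (v := delta_mx 0 i) Cg).
exists (m%:R * M) => [|y y' y1 y'1]; first by rewrite mulr_ge0.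
apply: (@C1_lipschitz_segment _ _ setT) => //; first exact: openT.
move=> s i /andP[s0 s1]; apply: HM.
have -> : y + s *: (y' - y) - y0 = (1 - s) *: (y - y0) + s *: (y' - y0).
  by apply/rowP => j; rewrite !mxE; ring.
rewrite (le_trans (ler_normD _ _))// !normrZ (ger0_norm s0) ger0_norm ?subr_ge0//.
have : (1 - s) * `|y - y0| <= 1 - s by rewrite ler_piMr// subr_ge0.
have : s * `|y' - y0| <= s by rewrite ler_piMr.
lra.
Qed.

Lemma norm_col'_le i x : `|col' i x| <= `|x|.
Proof. by apply: norm_le_coord => // j; rewrite mxE coord_le_norm. Qed.

(** At a boundary point [v] is a multiple of the coordinate direction along
    which [U] is the region above a graph. The multiple beats the Lipschitz
    constant of the graph, so that perturbing [v] by a vector of norm at most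
    one still leads into [U]. *)
Lemma inward_exists U x0 : open U -> smooth_boundary U -> closure U x0 ->
  exists v r, 0 < r /\ inward_within U r x0 v.
Proof.
move=> oU sU cx0; have [Ux0|nUx0] := pselect (U x0).
  have /nbhs_ballP[r /= r0 rU] := open_nbhs_nbhs (conj oU Ux0).
  exists 0, (r / 2); split; first by rewrite divr_gt0.
  move=> x t z _ xr /andP[t0 tr] z1; apply: rU; rewrite -ball_normE /ball_/= distrC.
  rewrite add0r addrAC (le_lt_trans (ler_normD _ _))// normrZ gtr0_norm//.
  have : t * `|z| <= t by rewrite ler_piMr// ltW.
  lra.
have [i [b [g [Cg /nbhs_ballP[r0 /= r00 r0P]]]]] :
    exists (i : 'I_n) (b : bool) (g : 'rV[R]_n.-1 -> R),
      smooth setT g /\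
      \forall x \near x0, U x <-> 0 < (-1) ^+ b * (x 0 i - g (col' i x)).
  by apply: sU; split=> // /interior_subset.
pose sg : R := (-1) ^+ b.
have sg2 : sg * sg = 1 by rewrite -expr2 sqrr_sign.
have sg1 : `|sg| = 1 by rewrite normr_sign.
pose h x := sg * (x 0 i - g (col' i x)).
have UP x : `|x - x0| < r0 -> U x <-> 0 < h x.
  by move=> xr; apply: r0P; rewrite -ball_normE /ball_/= distrC.
have [L L0 gL] := @C1_locally_lipschitz _ g (col' i x0) (Cg 1).
have hL x y : `|x - x0| <= 1 -> `|y - x0| <= 1 -> `|h y - h x| <= (1 + L) * `|y - x|.
  move=> x1 y1.
  have -> : h y - h x = sg * ((y - x) 0 i - (g (col' i y) - g (col' i x))).
    by rewrite /h !mxE; ring.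
  rewrite normrM sg1 mul1r (le_trans (ler_normB _ _))// mulrDl mul1r lerD//.
    exact: coord_le_norm.
  rewrite (le_trans (gL _ _ _ _))//.
  - by rewrite -linearB (le_trans (norm_col'_le _ _)).
  - by rewrite -linearB (le_trans (norm_col'_le _ _)).
  - by rewrite -linearB ler_wpM2l// norm_col'_le.
have h_ge0 x : closure U x -> `|x - x0| < Num.min r0 1 -> 0 <= h x.
  rewrite lt_min => cx /andP[xr x1]; rewrite leNgt; apply/negP => hx.
  pose d := Num.min (r0 - `|x - x0|) (Num.min (1 - `|x - x0|) (- h x / (1 + L))).
  have L1 : 0 < 1 + L by lra.
  have d0 : 0 < d.
    by rewrite !lt_min !subr_gt0 xr x1/= divr_gt0// oppr_gt0.
  have [y [Uy]] := cx _ (nbhsx_ballx x d d0).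
  rewrite -ball_normE /ball_/= distrC !lt_min => /and3P[y1 y2 y3].
  have yx0 : `|y - x0| <= `|y - x| + `|x - x0|.
    by rewrite -{1}(subrK x y) -addrA ler_normD.
  have hy : 0 < h y by apply/UP => //; lra.
  have := hL x y (ltW x1); rewrite (_ : `|y - x0| <= 1)//; last by lra.
  move=> /(_ isT); move: y3; rewrite ltr_pdivlMr// mulrC.
  by rewrite ler_norml => ? /andP[? ?]; lra.
have m0 : 0 < Num.min r0 1 by rewrite lt_min r00 ltr01.
exists ((2 + L) *: (sg *: delta_mx 0 i)), (Num.min r0 1 / (4 + L)).
split; first by rewrite divr_gt0// ltr_wpDr.
move=> x t z cx xr /andP[t0 tr] z1.
set v := (2 + L) *: _; set x' := x + _.
have vn : `|v| <= 2 + L.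
  rewrite normrZ normrZ sg1 mul1r ger0_norm ?addr_ge0// ler_piMr ?addr_ge0//.
  apply: norm_le_coord => // j; rewrite mxE eqxx/=.
  by case: (j == i); rewrite ?normr1 ?normr0.
have L4 : 0 < 4 + L by lra.
have xx : `|x' - x| <= t * (3 + L).
  rewrite /x' addrAC subrr add0r normrZ gtr0_norm// ler_pM2l//.
  by rewrite (le_trans (ler_normD _ _))//; lra.
have x'r : `|x' - x0| < Num.min r0 1.
  have : `|x' - x0| <= `|x' - x| + `|x - x0|.
    by rewrite -{1}(subrK x x') -addrA ler_normD.
  have qE : Num.min r0 1 = Num.min r0 1 / (4 + L) * (4 + L) by rewrite divfK// gt_eqF.
  have : t * (3 + L) <= Num.min r0 1 / (4 + L) * (3 + L).
    by rewrite ler_wpM2r ?(ltW tr)//; lra.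
  rewrite [ltRHS]qE; lra.
have x0r : `|x - x0| < Num.min r0 1.
  move: xr; rewrite ltr_pdivlMr//; apply: le_lt_trans.
  by rewrite ler_peMr//; lra.
have hx := h_ge0 x cx x0r.
move: x'r x0r; rewrite !lt_min => /andP[x'r x'1] /andP[xr0 x1].
apply/(UP x' x'r).
have cE : col' i x' - col' i x = t *: col' i z.
  apply/rowP => j; rewrite /x' /v !mxE.
  have -> : (lift i j == i) = false by apply/negbTE; rewrite eq_sym neq_lift.
  by rewrite andbF mulr0n; ring.
have gx : `|g (col' i x') - g (col' i x)| <= L * t.
  rewrite (le_trans (gL _ _ _ _))//.
  - by rewrite -linearB (le_trans (norm_col'_le _ _))// ltW.
  - by rewrite -linearB (le_trans (norm_col'_le _ _))// ltW.
  - rewrite cE normrZ gtr0_norm// ler_wpM2l// ler_piMr ?(ltW t0)//.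
    by rewrite (le_trans (norm_col'_le _ _)).
have -> : h x' = h x + t * (2 + L) + t * (sg * z 0 i)
    - sg * (g (col' i x') - g (col' i x)).
  have xi : x' 0 i = x 0 i + t * ((2 + L) * sg + z 0 i).
    by rewrite /x' /v !mxE !eqxx/= mulr1.
  rewrite /h xi.
  transitivity (sg * (x 0 i - g (col' i x)) + t * (2 + L) * (sg * sg) +
    t * (sg * z 0 i) - sg * (g (col' i x') - g (col' i x))); first by ring.
  by rewrite sg2 mulr1.
have A1 : - t <= t * (sg * z 0 i).
  have : `|t * (sg * z 0 i)| <= t.
    rewrite normrM normrM sg1 mul1r gtr0_norm// ler_piMr ?(ltW t0)//.
    exact: (le_trans (coord_le_norm _ _)).
  by rewrite ler_norml => /andP[].
have A2 : sg * (g (col' i x') - g (col' i x)) <= L * t.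
  by rewrite (le_trans (ler_norm _))// normrM sg1 mul1r.
(* the inward part [t (2 + L)] beats the errors [t] and [L t] *)
lra.
Qed.

End inward.

Definition uniformly_inward (R : realType) n (U : set 'rV[R]_n) (rho V : R) :=
  forall x0, closure U x0 -> exists2 v, `|v| <= V & inward_within U rho x0 v.

Lemma uniformly_inward_exists (R : realType) n (U : set 'rV[R]_n) :
  open U -> smooth_boundary U -> compact (closure U) ->
  exists rho V, [/\ 0 < rho, 0 <= V & uniformly_inward U rho V].
Proof.
move=> oU sU /compact_near_coveringP cU.
pose P r x0 := exists2 v, `|v| <= r^-1 & inward_within U r x0 v.
have A x0 : closure U x0 -> \forall x \near x0 & r \near (0 : R)^'+, P r x.
  move=> cx0; have [v [e [e0 ve]]] := inward_exists oU sU cx0.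
  have e20 : 0 < e / 2 by rewrite divr_gt0.
  have v0 : 0 < (`|v| + 1)^-1 by rewrite invr_gt0 ltr_wpDl.
  exists (ball x0 (e / 2), [set r | 0 < r /\ r < Num.min (e / 2) (`|v| + 1)^-1]).
    split => /=; first exact: nbhsx_ballx.
    have m0 : 0 < Num.min (e / 2) (`|v| + 1)^-1 by rewrite lt_min e20.
    exact: (filterI (nbhs_right_gt (0 : R)) (nbhs_right_lt m0)).
  move=> [x r] /= [xe [r0]]; rewrite lt_min => /andP[re rv]; exists v.
    have : `|v| + 1 < r^-1.
      by rewrite -[ltLHS]invrK ltf_pV2 ?posrE.
    lra.
  move=> y t z cy yx /andP[t0 tr] z1; apply: ve => //; last by rewrite t0/=; lra.
  move: xe; rewrite -ball_normE /ball_/= distrC => xe.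
  rewrite -(subrK x y) -addrA (le_lt_trans (ler_normD _ _))//; lra.
have A2 := cU R (at_right (0 : R)) P (at_right_proper_filter (0 : R)) A.
have A1 : \forall r \near (0 : R)^'+, 0 < r /\ closure U `<=` P r.
  exact: (filterI (nbhs_right_gt (0 : R)) A2).
have [r [r0 rP]] := filter_ex A1.
by exists r, r^-1; split => //; rewrite invr_ge0 ltW.
Qed.

Section exit.
Context {R : realType} {n : nat}.
Variables (U : set 'rV[R]_n) (w : 'rV[R]_n -> R) (L : R).
Hypotheses (oU : open U) (cw : {within closure U, continuous w})
  (bw : forall x, boundary U x -> w x = 0) (L0 : 0 <= L).

Lemma exit_point x z : U x -> ~ U z ->
  exists s : R, [/\ 0 < s <= 1, boundary U (x + s *: (z - x)) &
    forall s', 0 <= s' < s -> U (x + s' *: (z - x))].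
Proof.
move=> Ux nUz; pose ga s := x + s *: (z - x).
pose S := [set s : R | 0 <= s <= 1 /\ forall s', 0 <= s' <= s -> U (ga s')].
have ga_shift a s : ga (a + s) = ga a + s *: (z - x) by rewrite /ga scalerDl addrA.
have S0 : S 0.
  split; first by rewrite lexx ler01.
  by move=> s /le_anti <-; rewrite /ga scale0r addr0.
have ubS : ubound S 1 by move=> s [/andP[]].
have supS : has_sup S by split; [exists 0|exists 1].
pose t := sup S.
have t1 : t <= 1 by apply: ge_sup => //; exists 0.
have below s : 0 <= s < t -> U (ga s).
  move=> /andP[s0 st].
  have [s' [_ s'S]] := sup_adherent (eps := t - s) (ltac:(by rewrite subr_gt0)) supS.
  by rewrite subKr => ss'; apply: s'S; rewrite s0 ltW.
have extend a : 0 <= a <= 1 -> (forall s, 0 <= s <= a -> U (ga s)) -> a < 1 -> a < t.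
  move=> /andP[a0 a1'] Ha a1.
  have [|r r0 rU] := @nbhs_line R n U (ga a) (z - x) oU; first by apply: Ha; rewrite a0 lexx.
  pose d := Num.min (r / 2) (1 - a).
  have d0 : 0 < d by rewrite lt_min subr_gt0 a1 divr_gt0.
  have dr : d <= r / 2 by rewrite ge_min lexx.
  have d1 : d <= 1 - a by rewrite ge_min lexx orbT.
  suff : S (a + d) by move=> /(sup_upper_bound supS); rewrite -/t; lra.
  split; first by apply/andP; split; lra.
  move=> s /andP[s0 sa]; have [sa'|sa'] := leP s a; first by apply: Ha; rewrite s0.
  rewrite -(subrK a s) addrC ga_shift; apply: rU.
  by rewrite gtr0_norm ?subr_gt0//; lra.
have t0 : 0 < t.
  apply: extend => //; first by rewrite lexx ler01.
  by move=> s /le_anti <-; rewrite /ga scale0r addr0.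
have nUt : ~ U (ga t).
  move=> Ut; have [t1'|t1'] := ltP t 1.
    suff : t < t by rewrite ltxx.
    apply: extend => //; first by rewrite ltW.
    move=> s /andP[s0]; rewrite le_eqVlt => /orP[/eqP->//|st].
    by apply: below; rewrite s0.
  have tE : t = 1 by apply/eqP; rewrite eq_le t1.
  by apply: nUz; move: Ut; rewrite tE /ga scale1r addrC subrK.
exists t; split => //; first by rewrite t0.
split; last by move=> /interior_subset.
move=> B /nbhs_ballP[d /= d0 dB].
have M0 : 0 < `|z - x| + 1 by rewrite ltr_wpDl.
pose e := Num.min (t / 2) (d / 2 / (`|z - x| + 1)).
have e0 : 0 < e by rewrite lt_min !divr_gt0.
have et : e <= t / 2 by rewrite ge_min lexx.
exists (ga (t - e)); split; first by apply: below; apply/andP; split; lra.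
apply: dB; rewrite -ball_normE /ball_/= -/(ga t) ga_shift opprD addrA subrr sub0r.
rewrite normrN normrZ normrN gtr0_norm//.
have ed : e <= d / 2 / (`|z - x| + 1) by rewrite ge_min lexx orbT.
move: ed; rewrite ler_pdivlMr// mulrDr mulr1; lra.
Qed.

(** Follow the segment from [x] towards [z] up to its exit point, where [w]
    vanishes. *)
Lemma exit_le x z : (forall y, segment_in U x y -> w x - w y <= L * `|y - x|) ->
  U x -> ~ U z -> w x <= L * `|z - x|.
Proof.
move=> lw Ux nUz; have [t [/andP[t0 t1] bt below]] := exit_point Ux nUz.
apply/ler_addgt0Pl => e e0.
have := (subspace_continuousP (closure U) w).1 cw _ bt.1.
move=> /cvgrPdist_lt/(_ e e0); rewrite near_withinE => /nbhs_ballP[d /= d0 dP].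
have M0 : 0 < `|z - x| + 1 by rewrite ltr_wpDl.
pose c := Num.min (t / 2) (d / 2 / (`|z - x| + 1)).
have c0 : 0 < c by rewrite lt_min !divr_gt0.
have ct : c <= t / 2 by rewrite ge_min lexx.
have cd : c * `|z - x| <= d / 2.
  have : c <= d / 2 / (`|z - x| + 1) by rewrite ge_min lexx orbT.
  rewrite ler_pdivlMr// mulrDr mulr1; lra.
have Uc : U (x + (t - c) *: (z - x)) by apply: below; apply/andP; split; lra.
have wc : w (x + (t - c) *: (z - x)) < e.
  have := dP (x + (t - c) *: (z - x)); rewrite bw// sub0r normrN => H.
  apply: le_lt_trans (ler_norm _) (H _ _); last exact: subset_closure.
  rewrite -ball_normE /ball_/= opprD addrACA subrr add0r -scalerBl opprB addrC subrK.
  by rewrite normrZ gtr0_norm//; lra.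
have := lw (x + (t - c) *: (z - x)).
have -> : x + (t - c) *: (z - x) - x = (t - c) *: (z - x) by rewrite addrAC subrr add0r.
rewrite normrZ ger0_norm ?subr_ge0; last by lra.
have A : (t - c) * `|z - x| <= `|z - x| by rewrite ler_piMl//; lra.
have := ler_wpM2l L0 A.
suff : segment_in U x (x + (t - c) *: (z - x)) by move=> S + /(_ S); lra.
move=> s /andP[s0 s1].
have -> : x + (t - c) *: (z - x) - x = (t - c) *: (z - x) by rewrite addrAC subrr add0r.
rewrite scalerA; apply: below.
have B1 : 0 <= s * (t - c) by rewrite mulr_ge0//; lra.
have B2 : s * (t - c) <= t - c by rewrite ler_piMl//; lra.
apply/andP; split; lra.
Qed.

(** If the segment from [x] to [y] leaves [U] at some point, both values are
    controlled by the distances to that point, which add up to the distance from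
    [x] to [y]. *)
Lemma lipschitz_closure :
  (forall x y, segment_in U x y -> `|w x - w y| <= L * `|x - y|) ->
  (forall x z, U x -> ~ U z -> `|w x| <= L * `|x - z|) ->
  forall x y, closure U x -> closure U y -> `|w x - w y| <= L * `|x - y|.
Proof.
move=> lw lb x y cx cy.
have bd z : closure U z -> ~ U z -> w z = 0.
  by move=> cz nUz; apply: bw; split=> // /interior_subset.
have [Ux|nUx] := pselect (U x); last first.
  rewrite (bd x)// sub0r normrN.
  have [Uy|nUy] := pselect (U y); last by rewrite (bd y)// normr0 mulr_ge0.
  by rewrite distrC; exact: lb.
have [Uy|nUy] := pselect (U y); last by rewrite (bd y)// subr0; exact: lb.
have [S|] := pselect (segment_in U x y); first exact: lw.
move=> /existsNP[s /not_implyP[/andP[s0 s1] nUs]].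
rewrite (le_trans (ler_normB _ _))//.
have := lb _ _ Ux nUs; have := lb _ _ Uy nUs.
have -> : x - (x + s *: (y - x)) = s *: (x - y).
  by apply/rowP => j; rewrite !mxE; ring.
have -> : y - (x + s *: (y - x)) = (1 - s) *: (y - x).
  by apply/rowP => j; rewrite !mxE; ring.
rewrite !normrZ (distrC y x) (ger0_norm s0) (ger0_norm (x := 1 - s)) ?subr_ge0//.
lra.
Qed.

End exit.

(** * Doubling of variables *)

Lemma compact_max_bool (R : realType) (T : topologicalType) (K : set T) (F : bool -> T -> R) :
  K !=set0 -> compact K -> (forall i, {within K, continuous (F i)}) ->
  exists i c, K c /\ forall j c', K c' -> F j c' <= F i c.
Proof.
move=> K0 cK cF.
have [c1 + H1] := compact_EVT_max K0 cK (cF true).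
have [c2 + H2] := compact_EVT_max K0 cK (cF false).
rewrite !inE => K2 K1.
have [le|le] := leP (F true c1) (F false c2); [exists false, c2|exists true, c1].
- split=> // -[] c' Kc'; last by apply: H2; rewrite inE.
  by apply: le_trans le; apply: H1; rewrite inE.
- split=> // -[] c' Kc'; first by apply: H1; rewrite inE.
  by apply: le_trans (ltW le); apply: H2; rewrite inE.
Qed.

Section within.
Context {R : realType} {T T' : topologicalType}.

Lemma within_continuous_fst (A : set T) (B : set T') (f : T -> R) :
  {within A, continuous f} -> {within A `*` B, continuous (fun z => f z.1)}.
Proof.
move=> /subspace_continuousP cf; apply/subspace_continuousP => -[x y] [/= Ax By].
move=> P /(cf x Ax) H.
exists ([set x' | A x' -> P (f x')], setT); first by split => //; exact: filterT.
by move=> [x' y'] /= [HP _] [Ax' _]; exact: HP.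
Qed.

Lemma within_continuous_snd (A : set T) (B : set T') (f : T' -> R) :
  {within B, continuous f} -> {within A `*` B, continuous (fun z => f z.2)}.
Proof.
move=> /subspace_continuousP cf; apply/subspace_continuousP => -[x y] [/= Ax By].
move=> P /(cf y By) H.
exists (setT, [set y' | B y' -> P (f y')]); first by split => //; exact: filterT.
by move=> [x' y'] /= [_ HP] [_ By']; exact: HP.
Qed.

End within.

Lemma lipschitz_within_continuous (R : realType) (V : normedModType R) (A : set V)
    (f : V -> R) (L : R) : 0 <= L ->
  (forall x y, A x -> A y -> `|f x - f y| <= L * `|x - y|) ->
  {within A, continuous f}.
Proof.
move=> L0 lf; apply/subspace_continuousP => x Ax; apply/cvgrPdist_lt => e e0.
rewrite near_withinE; have L1 : 0 < L + 1 by lra.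
apply/nbhs_ballP; exists (e / (L + 1)); first exact: divr_gt0.
move=> y; rewrite -ball_normE /ball_/= ltr_pdivlMr// => xy Ay.
apply: le_lt_trans (lf _ _ Ax Ay) _; apply: le_lt_trans xy.
by rewrite mulrDr mulr1 mulrC lerDl.
Qed.

Section doubling.
Context {R : realType} {n : nat}.
Implicit Types (x y z p c : 'rV[R]_n).

(** The penalty is minimal at [y = x + t v]. Since [b] is Lipschitz and [t] is a
    large multiple of [del], the maximum satisfies [|y - x - t v| <= t], so that
    [y] is reached from [x] along an inward direction and lies in [U] together
    with the segment from [x]. The weak term [kap |x - xh|^2] keeps [x] in the
    ball where [v] is inward; a weight [kap] of order [del] is enough, since [xh]
    already maximizes [a - b]. The index [i] is part of the
    maximization, which links the two components of the system. *)
Lemma doubling_of_variables (U : set 'rV[R]_n) (a b : bool -> 'rV[R]_n -> R) (L rho V del : R) :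
  open U -> compact (closure U) -> U !=set0 ->
  uniformly_inward U rho V -> 0 < rho -> 0 <= V -> 0 <= L ->
  (forall i, {within closure U, continuous (a i)}) ->
  (forall i x y, closure U x -> closure U y -> `|b i x - b i y| <= L * `|x - y|) ->
  (forall i x, boundary U x -> a i x = 0 /\ b i x = 0) ->
  let A := 2 * L + 4 * L * V + 1 in
  let t := A * del in
  let k := (2 * del)^-1 in
  0 < del -> t < rho ->
  (forall i x, closure U x -> a i x - b i x <= L * (1 + 2 * V) * t) \/
  exists i x y c p,
  [/\ U x, U y, segment_in U x y, `|y - x| <= (1 + V) * t &
      [/\ (forall j, a j x - b j y <= a i x - b i y),
       (forall j z, closure U z -> a j z - b j z <= a i x - b i y + L * V * t),
       (forall y', U y' -> b i y + k * sqn (y - c) <= b i y' + k * sqn (y' - c)),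
       `|(2 * k) *: (y - c)| <= A &
       `|p + (2 * k) *: (y - c)| <= 2 * A ^+ 2 * del / rho /\
       forall j s, U (x + s *: delta_mx 0 j) ->
         a i (x + s *: delta_mx 0 j) <=
         a i x + p 0 j * s + (k + A ^+ 2 * del / rho ^+ 2) * s ^+ 2]].
Proof.
move=> oU cU U0 inU rho0 V0 L0 ca lb bd A t k del0 trho.
have A0 : 1 <= A.
  by have := mulr_ge0 L0 V0; rewrite /A; lra.
have t0 : 0 < t by rewrite mulr_gt0//; lra.
have k0 : 0 < k by rewrite invr_gt0 mulr_gt0.
have cU0 : closure U !=set0 by case: U0 => x Ux; exists x; exact: subset_closure.
have cb i : {within closure U, continuous (b i)}.
  by apply: (lipschitz_within_continuous L0) => x y cx cy; exact: lb.
have [i0 [xh [cxh Hxh]]] :=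
  @compact_max_bool R _ (closure U) (fun i x => a i x - b i x) cU0 cU
    (fun i x => continuousB (ca i x) (cb i x)).
have [v vV inv] := inU xh cxh.
pose kap := A ^+ 2 * del / rho ^+ 2.
have rho2 : 0 < rho ^+ 2 by rewrite exprn_gt0.
have kap0 : 0 < kap by rewrite divr_gt0// mulr_gt0// exprn_gt0//; lra.
have kapE : kap * rho ^+ 2 = A * t.
  by rewrite /kap divfK ?gt_eqF// /t expr2 mulrA.
pose pen x y := k * sqn (y - x - t *: v) + kap * sqn (x - xh).
have pen_ge0 x y : 0 <= pen x y by rewrite addr_ge0// mulr_ge0 ?sqn_ge0// ltW.
have cpen : continuous (fun z : 'rV[R]_n * 'rV[R]_n => pen z.1 z.2).
  have c1 : continuous (fun z : 'rV[R]_n * 'rV[R]_n => k * sqn (z.2 - z.1 - t *: v)).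
    move=> z; apply: (@continuous_comp _ _ _ (fun z : 'rV[R]_n * 'rV[R]_n => z.2 - z.1)
      (fun y => k * sqn (y - t *: v))); last exact: scaled_sqn_continuous.
    by apply: (@continuousB _ _ _ snd fst); [exact: cvg_snd|exact: cvg_fst].
  have c2 : continuous (fun z : 'rV[R]_n * 'rV[R]_n => kap * sqn (z.1 - xh)).
    move=> z; apply: (@continuous_comp _ _ _ fst (fun x => kap * sqn (x - xh))).
      exact: cvg_fst.
    exact: scaled_sqn_continuous.
  by move=> z; exact: continuousD (c1 z) (c2 z).
have cF i : {within closure U `*` closure U, continuous
    (fun z : 'rV[R]_n * 'rV[R]_n => a i z.1 - b i z.2 - pen z.1 z.2)}.
  have c1 := within_continuous_fst (B := closure U) (ca i).
  have c2 := within_continuous_snd (A := closure U) (cb i).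
  have c3 := continuous_subspaceT (A := closure U `*` closure U) cpen.
  by move=> z; exact: continuousB (continuousB (c1 z) (c2 z)) (c3 z).
have UU0 : closure U `*` closure U !=set0.
  by case: cU0 => x0 Ux0; exists (x0, x0).
have [i [[x y] [/= [cx cy] Hxy]]] := compact_max_bool UU0 (compact_setX cU cU) cF.
have {}Hxy j x' y' : closure U x' -> closure U y' ->
    a j x' - b j y' - pen x' y' <= a i x - b i y - pen x y.
  by move=> cx' cy'; exact: (Hxy j (x', y')).
pose S := a i0 xh - b i0 xh.
have Uxt : U (xh + t *: v).
  rewrite -[v]addr0; apply: inv => //; rewrite ?subrr ?normr0//.
  by rewrite t0.
(* the competitor [(xh, xh + t v)] has no penalty *)
have NS : S - L * (t * V) <= a i x - b i y - pen x y.
  have := Hxy i0 xh (xh + t *: v) cxh (subset_closure Uxt).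
  have -> : pen xh (xh + t *: v) = 0.
    by rewrite /pen addrAC addrK !subrr sqn0 !mulr0 addr0.
  have := lb i0 _ _ (subset_closure Uxt) cxh.
  rewrite addrAC subrr add0r normrZ gtr0_norm// ler_norml /S => /andP[_ B1].
  have : L * (t * `|v|) <= L * (t * V) by rewrite ler_wpM2l// ler_wpM2l// ltW.
  lra.
have bxy : b i x - b i y <= L * `|y - x|.
  by rewrite distrC (le_trans (ler_norm _))// lb.
have penle : pen x y <= L * `|y - x| + L * (t * V).
  by have := Hxh i x cx; rewrite /S in NS; lra.
pose r := `|y - x - t *: v|.
have yxr : `|y - x| <= r + t * V.
  rewrite -{1}(subrK (t *: v) (y - x)) (le_trans (ler_normD _ _))// lerD2l.
  by rewrite normrZ gtr0_norm// ler_wpM2l// ltW.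
have kr : k * r ^+ 2 <= pen x y.
  rewrite /pen -[leLHS]addr0 lerD//; last exact: mulr_ge0 (ltW kap0) (sqn_ge0 _).
  by rewrite ler_wpM2l ?(ltW k0)// norm_sqr_le_sqn.
have LV0 : 0 <= L * V by rewrite mulr_ge0.
have kd : k * (2 * del) = 1 by rewrite mulVf// mulf_neq0 ?gt_eqF.
have penle' : pen x y <= L * r + 2 * (L * V) * t.
  by have := ler_wpM2l L0 yxr; lra.
(* if [r > t = A del], then [k r^2 > A r / 2], which contradicts [penle'] *)
have rt : r <= t.
  rewrite leNgt; apply/negP => tr.
  have r0 : 0 < r by exact: lt_trans tr.
  have B1 : A * r <= 2 * (k * r ^+ 2).
    have -> : A * r = 2 * k * (A * del * r).
      by transitivity (A * r * (k * (2 * del))); [rewrite kd mulr1|ring].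
    rewrite mulrA ler_wpM2l ?mulr_ge0 ?(ltW k0)// expr2 ler_wpM2r ?(ltW r0)//.
    exact: ltW.
  have B2 : 2 * (L * V) * t <= 2 * (L * V) * r.
    by rewrite ler_wpM2l ?mulr_ge0// ltW.
  have B3 : A * r = 2 * (L * r) + 4 * (L * V) * r + r by rewrite /A; ring.
  lra.
have yxt : `|y - x| <= (1 + V) * t by lra.
have xxh : `|x - xh| < rho.
  have B1 : kap * `|x - xh| ^+ 2 <= pen x y.
    rewrite /pen -[leLHS]add0r lerD//; first exact: mulr_ge0 (ltW k0) (sqn_ge0 _).
    by rewrite ler_wpM2l ?(ltW kap0)// norm_sqr_le_sqn.
  have B2 : L * r <= L * t by rewrite ler_wpM2l.
  have B3 : A * t = 2 * (L * t) + 4 * (L * V) * t + t by rewrite /A; ring.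
  have B4 : 0 <= L * t by rewrite mulr_ge0// ltW.
  have B5 : 0 <= (L * V) * t by rewrite mulr_ge0// ltW.
  have : kap * `|x - xh| ^+ 2 < kap * rho ^+ 2 by rewrite kapE; lra.
  by rewrite ltr_pM2l// ltr_sqr// nnegrE// ltW.
have [Ux|nUx] := pselect (U x); last first.
  left=> j z cz; have [ax0 bx0] : a i x = 0 /\ b i x = 0.
    by apply: bd; split => // /interior_subset.
  have := Hxh j z cz; have := ler_wpM2l L0 yxt; have := pen_ge0 x y.
  rewrite /S in NS; rewrite ax0 in NS; rewrite bx0 in bxy.
  lra.
right; pose w := y - x - t *: v.
have yE : y = x + t *: (v + t^-1 *: w).
  rewrite scalerDr scalerA divff ?gt_eqF// scale1r /w.
  by apply/rowP => j; rewrite !mxE; ring.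
have w1 : `|t^-1 *: w| <= 1.
  by rewrite normrZ gtr0_norm ?invr_gt0// ler_pdivrMl// mulr1.
have yxE s : s *: (y - x) = (s * t) *: (v + t^-1 *: w).
  by rewrite {1}yE addrAC subrr add0r scalerA.
have Us s : 0 <= s <= 1 -> U (x + s *: (y - x)).
  move=> /andP[s0 s1]; move: s0; rewrite le_eqVlt => /orP[/eqP<-|s0].
    by rewrite scale0r addr0.
  rewrite yxE; apply: inv => //; rewrite mulr_gt0//=.
  by apply: le_lt_trans trho; rewrite ler_piMl// ltW.
have Uy : U y.
  have := Us 1; rewrite scale1r addrC subrK; apply; by rewrite ler01 lexx.
exists i, x, y, (x + t *: v), (- ((2 * k) *: w) + (2 * kap) *: (x - xh)).
have yc : y - (x + t *: v) = w by rewrite /w opprD addrA.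
split => //; rewrite yc; split.
- by move=> j; have := Hxy j x y cx cy; lra.
- by move=> j z cz; have := Hxh j z cz; have := pen_ge0 x y; rewrite /S in NS; lra.
- move=> y' Uy'; have := Hxy i x y' cx (subset_closure Uy').
  by rewrite /pen -!(addrA _ (- x)) -!opprD yc; lra.
- rewrite normrZ gtr0_norm ?mulr_gt0//.
  have -> : A = 2 * k * t.
    by transitivity (A * (k * (2 * del))); [rewrite kd mulr1|rewrite /t; ring].
  by rewrite ler_pM2l ?mulr_gt0.
split.
  have kap20 : 0 < 2 * kap by exact: mulr_gt0.
  rewrite addrAC addNr add0r normrZ (gtr0_norm kap20).
  have -> : 2 * A ^+ 2 * del / rho = 2 * kap * rho.
    by rewrite /kap; field; rewrite gt_eqF.
  by rewrite ler_pM2l// ltW.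
move=> j s Us'; have := Hxy i (x + s *: delta_mx 0 j) y (subset_closure Us') cy.
rewrite /pen.
have -> : y - (x + s *: delta_mx 0 j) - t *: v = w + (- s) *: delta_mx 0 j.
  by apply/rowP => l; rewrite /w !mxE; ring.
have -> : x + s *: delta_mx 0 j - xh = (x - xh) + s *: delta_mx 0 j.
  by rewrite addrAC.
rewrite -/w !sqnD !sqnZ !dotZr !dot_delta !sqn_delta !mxE -/kap.
set X := sqn w; set Y := sqn (x - xh).
have -> : (y 0 j - x 0 j - t * v 0 j) = w 0 j by rewrite /w !mxE.
lra.
Qed.

End doubling.

(** * Estimates on the Hamiltonian *)

Lemma bool_bound (R : realType) (P : bool -> R -> Prop) :
  (forall i (a b : R), a <= b -> P i a -> P i b) ->
  (forall i, exists2 M : R, 0 <= M & P i M) ->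
  exists2 M : R, 0 <= M & forall i, P i M.
Proof.
move=> mP H; have [M1 M10 P1] := H true; have [M2 M20 P2] := H false.
exists (M1 + M2); first by rewrite addr_ge0.
by case; [apply: mP P1|apply: mP P2]; lra.
Qed.

Section hamiltonian.
Context {R : realType} {n : nat}.
Variables (U : set 'rV[R]_n) (K : R) (H : 'rV[R]_n -> 'rV[R]_n -> R).
Hypotheses (oU : open U) (cU : compact (closure U))
  (HP : admissible_hamiltonian U K H).
Implicit Types (x y p q : 'rV[R]_n).

Lemma norm_le_enorm p : `|p| <= enorm p.
Proof.
apply: norm_le_coord => [|i]; first exact: sqrtr_ge0.
rewrite -sqrtr_sqr ler_sqrt ?sumr_ge0// => [|j _]; last exact: sqr_ge0.
by rewrite (bigD1 i)//= lerDl sumr_ge0// => j _; exact: sqr_ge0.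
Qed.

Lemma hamiltonian_coercive B : exists2 r, 0 <= r & forall x p, closure U x ->
  H x p <= B -> `|p| <= r.
Proof.
have [_ _ /(_ 1)[r Hr] _] := HP.
exists (`|r| + `|B|); first by rewrite addr_ge0.
move=> x p cx HB; rewrite (le_trans (norm_le_enorm p))// leNgt; apply/negP => pr.
have rr := ler_norm r; have BB := ler_norm B.
have r0 : 0 <= `|r| by []; have B0 : 0 <= `|B| by [].
have p0 : 0 < enorm p by lra.
have := Hr x p cx; rewrite ler_pdivlMr// mul1r.
by move=> /(_ ltac:(lra)); lra.
Qed.

Lemma hamiltonian_bounded r : exists2 B, 0 <= B & forall x p, closure U x ->
  `|p| <= r -> `|H x p| <= B.
Proof.
have [/(_ 0)[_ cH _] _ _ _] := HP.
have sub : closure U `*` [set p : 'rV[R]_n | `|p| <= r] `<=`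
    closure (U `*` [set: 'rV[R]_n]).
  move=> [x p] [/= cx _] B [[B1 B2] /= [nB1 nB2] B12].
  have [y [Uy B1y]] := cx _ nB1.
  by exists (y, p); split => //; apply: B12; split => //=; exact: nbhs_singleton.
have cB : compact (closure U `*` [set p : 'rV[R]_n | `|p| <= r]).
  apply: compact_setX => //; have := @closed_ball_compact R n 0 r.
  by congr compact; apply/seteqP; split => p /=; rewrite subr0.
have [B B0 HB] := bounded_on_compact cB (continuous_subspaceW sub cH).
by exists B => // x p cx pr; exact: (HB (x, p)).
Qed.

Lemma hamiltonian_convex x p q t : closure U x -> 0 <= t <= 1 ->
  H x (t *: p + (1 - t) *: q) <= t * H x p + (1 - t) * H x q.
Proof.
move=> cx t01; have [_ /(_ x cx) cH _ _] := HP.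
move: t01 => /andP[t0 t1]; have := cH (Itv01 t0 t1) p q.
by rewrite !inE => /(_ I I).
Qed.

(** A bounded convex function is Lipschitz: extend the segment from [p] to [q]
    to length one and compare slopes. *)
Lemma hamiltonian_lipschitz_p r : exists2 M, 0 <= M & forall x p q, closure U x ->
  `|p| <= r -> `|q - p| <= 1 -> `|H x q - H x p| <= M * `|q - p|.
Proof.
have [B B0 HB] := hamiltonian_bounded (r + 2).
have one x p q : closure U x -> `|p| <= r + 1 -> `|q - p| <= 1 ->
    H x q - H x p <= 2 * B * `|q - p|.
  move=> cx pr qp; have [->|qp0] := eqVneq q p; first by rewrite !subrr normr0 mulr0.
  pose l := `|q - p|; have l0 : 0 < l by rewrite normr_gt0 subr_eq0.
  pose w := p + l^-1 *: (q - p).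
  have qE : q = l *: w + (1 - l) *: p.
    rewrite /w scalerDr scalerA divff ?gt_eqF// scale1r.
    by apply/rowP => j; rewrite !mxE; ring.
  have w1 : `|w| <= r + 2.
    rewrite (le_trans (ler_normD _ _))// normrZ gtr0_norm ?invr_gt0// -/l mulVf ?gt_eqF//.
    lra.
  have := hamiltonian_convex w p cx (_ : 0 <= l <= 1); rewrite -qE => /(_ ltac:(by rewrite ltW)).
  have /ler_normlP[_ h1] := HB x w cx w1.
  have /ler_normlP[h2 _] := HB x p cx ltac:(lra).
  have : l * (H x w - H x p) <= l * (2 * B) by rewrite ler_wpM2l ?(ltW l0)//; lra.
  rewrite -/l; lra.
exists (2 * B) => [|x p q cx pr qp]; first by rewrite mulr_ge0.
apply/ler_normlP; split; last by apply: one => //; lra.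
rewrite opprB distrC; apply: one => //; last by rewrite distrC.
have := ler_normD (q - p) p; rewrite subrK; lra.
Qed.

Lemma Ck1_hamiltonian p : Ck 1 U (fun y => H y p).
Proof.
have [/(_ 1)[CH _ _] _ _ _] := HP.
pose F (z : 'rV[R]_n * 'rV[R]_n) := H z.1 z.2.
have E v x : (fun h : R => h^-1 *: (((fun y => H y p) \o shift x) (h *: v) - H x p)) =
   (fun h : R => h^-1 *: ((F \o shift (x, p)) (h *: (v, 0)) - F (x, p))).
  by apply/funext => h /=; rewrite /F /= scaler0 add0r.
have DE v x : 'D_v (fun y => H y p) x = 'D_(v, 0) F (x, p) by rewrite /derive E.
have cp x : {for x, continuous (fun y : 'rV[R]_n => (y, p))}.
  move=> B [[B1 B2] [/= n1 n2] sub]; apply: (filterS _ n1) => y By.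
  by apply: sub; split => //=; exact: nbhs_singleton.
move=> [|v [|//]] _ x Ux; have UF : (U `*` setT) (x, p) by [].
- split => [|_ v].
    exact: (continuous_comp (cp x) (Ck_continuous CH UF)).
  by rewrite /derivable E; exact: (Ck1_derivable (v := (v, 0)) CH UF).
- split => //=.
  have -> : 'D_v (fun y => H y p) = 'D_(v, 0) F \o (fun y => (y, p)) by apply/funext.
  exact: (continuous_comp (cp x) (Ck1_derive_continuous (v := (v, 0)) CH UF)).
Qed.

Lemma grad_closure_interior f x : Ck 1 U f -> U x -> grad_closure U f x = grad f x.
Proof.
move=> Cf Ux; apply/rowP => i; rewrite !mxE.
rewrite within_interior; last by rewrite (interior_id U).1.
by apply/cvg_lim => //; exact: (Ck1_derive_continuous (v := delta_mx 0 i) Cf Ux).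
Qed.

(** Inside [U] the bound on [grad_closure] is a bound on the classical gradient
    in [x], uniform in [p]. *)
Lemma hamiltonian_lipschitz_x x y p : segment_in U x y ->
  `|H y p - H x p| <= n%:R * K * `|y - x|.
Proof.
move=> S; have [_ _ _ HK] := HP.
apply: (C1_lipschitz_segment oU (Ck1_hamiltonian p) S) => s i s01.
have Us := S s s01.
have := HK _ p (subset_closure Us); rewrite grad_closure_interior//; last exact: Ck1_hamiltonian.
apply: le_trans; have -> : partial i (H^~ p) (x + s *: (y - x)) =
   grad (H^~ p) (x + s *: (y - x)) 0 i by rewrite mxE.
exact: le_trans (coord_le_norm _ _) (norm_le_enorm _).
Qed.

End hamiltonian.

(** * The limit system *)

Lemma segment_in_sym (R : realType) n (U : set 'rV[R]_n) x y : segment_in U x y -> segment_in U y x.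
Proof.
move=> S s /andP[s0 s1]; have := S (1 - s).
have -> : x + (1 - s) *: (y - x) = y + s *: (x - y).
  by apply/rowP => j; rewrite !mxE; ring.
by apply; apply/andP; split; lra.
Qed.

Section limit_problem.
Context {R : realType} {n : nat}.
Variables (U : set 'rV[R]_n) (K alpha : R).
Variables (H : bool -> 'rV[R]_n -> 'rV[R]_n -> R) (psi u Phi : bool -> 'rV[R]_n -> R).
Hypotheses (oU : open U) (cU : compact (closure U)) (U0 : U !=set0)
  (HP : forall i, admissible_hamiltonian U K (H i))
  (alpha0 : 0 < alpha) (psi_ge : forall i x, closure U x -> alpha <= psi i x)
  (PhiP : forall i, strict_C1_subsolution U (H i) (Phi i))
  (PhiD : forall i x, closure U x -> Phi i x - Phi (~~ i) x <= psi i x)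
  (cu : forall i, {within closure U, continuous (u i)})
  (uP : forall i, viscosity_solution U (obstacle_operator (H i) (psi i) (u (~~ i))) (u i))
  (u0 : forall i x, boundary U x -> u i x = 0).

Lemma subsolution_le i phi x : Ck 1 U phi -> U x ->
  (\forall y \near x, u i y - phi y <= u i x - phi x) ->
  u i x - u (~~ i) x <= psi i x /\ u i x + H i x (grad phi x) <= 0.
Proof.
move=> Cphi Ux tch; have [/(_ phi Cphi x Ux tch) + _] := uP i.
by rewrite /obstacle_operator ge_max => /andP[]; rewrite subr_le0.
Qed.

Lemma supersolution_ge i phi x : Ck 1 U phi -> U x ->
  (\forall y \near x, u i x - phi x <= u i y - phi y) ->
  psi i x <= u i x - u (~~ i) x \/ 0 <= u i x + H i x (grad phi x).
Proof.
move=> Cphi Ux tch; have [_ /(_ phi Cphi x Ux tch)] := uP i.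
by rewrite /obstacle_operator le_max => /orP[]; rewrite ?subr_ge0; [left|right].
Qed.

Lemma Phi_interior i x : U x -> Phi i x + H i x (grad (Phi i) x) < 0.
Proof.
move=> Ux; have [C2 _ _ H0] := PhiP i.
by have := H0 x (subset_closure Ux); rewrite grad_closure_interior//; exact: Ck_le C2.
Qed.

(** At a positive maximum of [Phi j - u j] over the index and the point, the
    strict inequality for [Phi j] rules out the equation, so obstacle [j] is
    active; as [Phi] respects the obstacles, the other index realizes the same
    maximum and its obstacle is active too. The sum of both obstacles would be
    nonpositive. *)
Lemma Phi_le i x : closure U x -> Phi i x <= u i x.
Proof.
have cPhi j : {within closure U, continuous (Phi j)} by have [_ [_ ? _]] := PhiP j.
have cF j : {within closure U, continuous (fun x => Phi j x - u j x)}.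
  by move=> z; exact: continuousB (cPhi j z) (@cu j z).
have cU0 : closure U !=set0 by case: U0 => z /subset_closure; exists z.
have [j [c [cc Hc]]] := compact_max_bool cU0 cU cF.
move=> cx; have := Hc i x cx.
suff : Phi j c <= u j c by lra.
rewrite leNgt; apply/negP => lt.
have Uc : U c.
  apply: contrapT => nUc; have bc : boundary U c by split => // /interior_subset.
  have [_ _ P0 _] := PhiP j; by move: lt; rewrite u0// P0// ltxx.
have act k : (forall j' c', closure U c' -> Phi j' c' - u j' c' <= Phi k c - u k c) ->
    u k c < Phi k c -> psi k c <= u k c - u (~~ k) c.
  move=> Hk ltk; have [C2 _ _ _] := PhiP k.
  have [||//|] := @supersolution_ge k (Phi k) c _ Uc.
  - exact: Ck_le C2.
  - apply: (filterS _ (open_nbhs_nbhs (conj oU Uc))) => y Uy.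
    by have := Hk k y (subset_closure Uy); lra.
  - by have := Phi_interior k Uc; lra.
have a1 := act j Hc lt.
have a2 := PhiD j (subset_closure Uc).
have a3 := Hc (~~ j) c cc.
have a4 : psi (~~ j) c <= u (~~ j) c - u (~~ ~~ j) c.
  apply: act; last by lra.
  by move=> j' c' cc'; have := Hc j' c' cc'; lra.
move: a4; rewrite negbK => a4.
have := psi_ge j cc; have := psi_ge (~~ j) cc; have := alpha0; lra.
Qed.

(** [Phi] satisfies the gradient bound of [lipschitz_segment] because its
    classical gradient is the slope of any touching paraboloid. *)
Lemma Phi_quadratic_touch i c k z : U z ->
  (\forall y \near z, Phi i y - k * sqn (y - c) <= Phi i z - k * sqn (z - c)) ->
  grad (Phi i) z = (2 * k) *: (z - c).
Proof.
move=> Uz tch; have [C2 _ _ _] := PhiP i.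
(* a local maximum is a maximum on the open set [D] *)
pose D := [set y | U y /\ Phi i y - k * sqn (y - c) <= Phi i z - k * sqn (z - c)]°.
have Dz : D z.
  by apply: filterI; [exact: open_nbhs_nbhs|exact: tch].
have DU : D `<=` U by move=> y /interior_subset[].
have CD : Ck 2 D (Phi i) by move=> vs vsk y /DU; exact: C2.
have [|-> //] := touch_above (p := (2 * k) *: (z - c)) (be := k) (open_interior _) CD Dz.
move=> j s /interior_subset[_].
have -> : z + s *: delta_mx 0 j - c = (z - c) + s *: delta_mx 0 j by rewrite addrAC.
rewrite !sqnD !sqnZ !dotZr !dot_delta !sqn_delta !mxE; lra.
Qed.

Lemma limit_bounded : exists2 B, 0 <= B & forall i x, closure U x -> `|u i x| <= B.
Proof.
have [||B B0 HB] := @bool_bound R (fun i B => forall x, closure U x -> `|u i x| <= B).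
- by move=> i a b ab Ha x /Ha /le_trans; exact.
- by move=> i; exact: bounded_on_compact.
- by exists B.
Qed.

Lemma continuous_inside (f : 'rV[R]_n -> R) x :
  {within closure U, continuous f} -> U x -> {for x, continuous f}.
Proof.
move=> /(continuous_subspaceW (@subset_closure _ U)) cf Ux.
by move: cf; rewrite continuous_open_subspace// => /(_ x); rewrite inE; exact.
Qed.

(** Both [u] and [Phi] have bounded gradients in the viscosity sense, by
    coercivity. Hence [Phi] too is Lipschitz along segments, and being a lower
    bound of [u] that vanishes on the boundary it controls [u] from below
    there; from above [u] is controlled by its own bound along segments. *)
Lemma limit_lipschitz : exists2 L, 0 <= L &
  forall i x y, closure U x -> closure U y -> `|u i x - u i y| <= L * `|x - y|.
Proof.
have [B B0 HB] := limit_bounded.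
have cPhi j : {within closure U, continuous (Phi j)} by have [_ [_ ? _]] := PhiP j.
have [||B' B'0 HB'] := @bool_bound R (fun i B => forall x, closure U x -> `|Phi i x| <= B).
- by move=> i a b ab Ha x /Ha /le_trans; exact.
- by move=> i; exact: bounded_on_compact.
have [||r r0 Hr] := @bool_bound R (fun i r => forall x p, closure U x ->
  H i x p <= B + B' -> `|p| <= r).
- by move=> i a b ab Ha x p cx /(Ha _ _ cx) /le_trans; exact.
- by move=> i; exact: hamiltonian_coercive (HP i) _.
have segL (w : bool -> 'rV[R]_n -> R) :
    (forall i, {within closure U, continuous (w i)}) ->
    (forall i, exists2 M, 0 <= M & forall x, closure U x -> `|w i x| <= M) ->
    (forall i c k z, 0 < k -> U z ->
      (\forall y \near z, w i y - k * sqn (y - c) <= w i z - k * sqn (z - c)) ->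
     `|(2 * k) *: (z - c)| <= r) ->
    forall i x y, segment_in U x y -> w i x - w i y <= n%:R * r * `|y - x|.
  move=> cw bw Hw i x y S; have [M M0 HM] := bw i.
  apply: (@lipschitz_segment _ _ U (w i) M r) => //.
  - by move=> z Uz; exact: continuous_inside.
  - by move=> z Uz; apply: HM; exact: subset_closure.
  - by move=> c k z; exact: Hw.
have uL : forall i x y, segment_in U x y -> u i x - u i y <= n%:R * r * `|y - x|.
  apply: segL => // [i|i c k z k0 Uz tch]; first by exists B => // x; exact: HB.
  have [_] := subsolution_le (Ck1_sqn (D := U) k c) Uz tch.
  rewrite grad_sqn => h; apply: (Hr i z _ (subset_closure Uz)).
  have /ler_normlP[] := HB i z (subset_closure Uz); lra.
have PL : forall i x y, segment_in U x y -> Phi i x - Phi i y <= n%:R * r * `|y - x|.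
  apply: segL => // [i|i c k z k0 Uz tch]; first by exists B' => // x; exact: HB'.
  rewrite -(Phi_quadratic_touch Uz tch); apply: (Hr i z _ (subset_closure Uz)).
  have := Phi_interior i Uz.
  have /ler_normlP[] := HB' i z (subset_closure Uz); lra.
exists (n%:R * r); first by rewrite mulr_ge0.
have nr0 : 0 <= n%:R * r by rewrite mulr_ge0.
move=> i; apply: lipschitz_closure => //.
- exact: u0.
- move=> x y S; apply/ler_normlP; split; last by rewrite distrC; exact: uL.
  by rewrite opprB; apply: uL; exact: segment_in_sym.
- move=> x z Ux nUz; apply/ler_normlP; split; last first.
    rewrite distrC; apply: (@exit_le _ _ U) => //; first exact: u0.
    by move=> y; exact: uL.
  apply: (@le_trans _ _ (- Phi i x)); first by rewrite lerN2 Phi_le//; exact: subset_closure.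
  rewrite distrC; apply: (@exit_le _ _ U (fun y => - Phi i y)) => //.
  + by move=> y; exact: continuousN (cPhi i y).
  + by move=> y bby; have [_ _ P0 _] := PhiP i; rewrite P0 ?oppr0.
  + move=> y S; rewrite opprK addrC distrC; apply: PL; exact: segment_in_sym.
Qed.

End limit_problem.

(** * The penalized system *)

Section estimates.
Context {R : realType} {n : nat}.
Variables (U : set 'rV[R]_n) (alpha : R) (gamma : R -> R).
Variables (H : bool -> 'rV[R]_n -> 'rV[R]_n -> R) (psi u : bool -> 'rV[R]_n -> R).
Variables (rho V L Bu Lp BH M N : R).
Hypotheses (oU : open U) (cU : compact (closure U)) (U0 : U !=set0)
  (rho0 : 0 < rho) (V0 : 0 <= V) (inU : uniformly_inward U rho V)
  (alpha0 : 0 < alpha) (psi_ge : forall i x, closure U x -> alpha <= psi i x)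
  (Lp0 : 0 <= Lp)
  (psiL : forall i x y, segment_in U x y -> `|psi i y - psi i x| <= Lp * `|y - x|)
  (L0 : 0 <= L)
  (uL : forall i x y, closure U x -> closure U y ->
     `|u i x - u i y| <= L * `|x - y|)
  (Bu0 : 0 <= Bu) (uB : forall i x, closure U x -> `|u i x| <= Bu)
  (u0 : forall i x, boundary U x -> u i x = 0)
  (uP : forall i, viscosity_solution U (obstacle_operator (H i) (psi i) (u (~~ i))) (u i))
  (gamma_npos : forall s, s <= 0 -> gamma s = 0)
  (gamma_pos : forall s, 0 < s -> 0 < gamma s).

(** The momentum bound delivered by [doubling_of_variables] for functions with
    Lipschitz constant [2 * L], such as [(1 + eta) * u] with [eta <= 1]. *)
Let A := 2 * (2 * L) + 4 * (2 * L) * V + 1.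

Hypotheses (BH0 : 0 <= BH)
  (HB : forall i x p, closure U x -> `|p| <= 2 * A + 1 -> `|H i x p| <= BH)
  (HC : forall i x p q t, closure U x -> 0 <= t <= 1 ->
     H i x (t *: p + (1 - t) *: q) <= t * H i x p + (1 - t) * H i x q)
  (M0 : 0 <= M) (HM : forall i x p q, closure U x -> `|p| <= A -> `|q - p| <= 1 ->
     `|H i x q - H i x p| <= M * `|q - p|)
  (N0 : 0 <= N) (HN : forall i x y p, segment_in U x y ->
     `|H i y p - H i x p| <= N * `|y - x|).

(** Bounds, divided by [del = sqrt eps], on the following quantities at the
    doubling point: the distance between [x] and [y], the difference of the two
    slopes, and [eps] times the Laplacian. The last one, [eta_rate], is [eta]
    divided by [del], chosen so that [eta * alpha] covers the variation of the
    obstacle between [x] and [y] and a margin [del]. *)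
Let dist_rate := (1 + V) * A.
Let slope_rate := 2 * A ^+ 2 / rho.
Let viscous_rate := n%:R * (1 + 2 * A ^+ 2 / rho ^+ 2).
Let eta_rate := (Lp * dist_rate + 1) / alpha.

Let A1 : 1 <= A.
Proof. by have := mulr_ge0 L0 V0; rewrite /A; have := L0; lra. Qed.
Let dist_rate_ge0 : 0 <= dist_rate.
Proof. by rewrite mulr_ge0//; [have := V0|have := A1]; lra. Qed.
Let slope_rate_ge0 : 0 <= slope_rate.
Proof. by rewrite /slope_rate divr_ge0 ?(ltW rho0)// mulr_ge0// sqr_ge0. Qed.
Let viscous_rate_ge0 : 0 <= viscous_rate.
Proof. by rewrite /viscous_rate mulr_ge0// addr_ge0// divr_ge0 ?sqr_ge0// mulr_ge0// sqr_ge0. Qed.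
Let eta_rate_gt0 : 0 < eta_rate.
Proof. by rewrite divr_gt0// ltr_wpDl// mulr_ge0. Qed.

Lemma gamma_ge0 s : 0 <= gamma s.
Proof. by have [/gamma_npos->//|/gamma_pos/ltW] := leP s 0. Qed.

Definition penalized_constant :=
  2 * L * (1 + 2 * V) * A + 2 * L * V * A + viscous_rate + M * slope_rate + N * dist_rate +
  eta_rate * BH.

Lemma hamiltonian_compare i x y p q del : 0 <= del -> slope_rate * del <= 1 -> segment_in U x y ->
  `|y - x| <= dist_rate * del -> `|q| <= A -> `|p - q| <= slope_rate * del ->
  `|H i x p - H i y q| <= (M * slope_rate + N * dist_rate) * del.
Proof.
move=> del0 slope_le1 S yx qA pq.
have Ux : U x by have := S 0; rewrite scale0r addr0 lexx ler01; exact.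
have h1 : `|H i x p - H i x q| <= M * (slope_rate * del).
  apply: (le_trans (HM i (subset_closure Ux) qA (le_trans pq slope_le1))).
  by rewrite ler_wpM2l.
have h2 : `|H i y q - H i x q| <= N * (dist_rate * del).
  by apply: (le_trans (HN i q S)); rewrite ler_wpM2l.
rewrite -(subrKA (H i x q)) (le_trans (ler_normD _ _))// (distrC (H i x q)).
have -> : (M * slope_rate + N * dist_rate) * del =
    M * (slope_rate * del) + N * (dist_rate * del) by ring.
exact: lerD h1 h2.
Qed.

Section fixed_eps.
Variables (del : R) (ue : bool -> 'rV[R]_n -> R).
Hypotheses (del0 : 0 < del) (del1 : del <= 1) (delrho : A * del < rho)
  (slope_le1 : slope_rate * del <= 1) (eta_le : eta_rate * del <= 1 / 2)
  (gamma_large : forall s, del^-1 <= s -> viscous_rate + 2 * Bu + BH < gamma s).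
Hypotheses (ueC2 : forall i, Ck 2 U (ue i))
  (uec : forall i, {within closure U, continuous (ue i)})
  (ue0 : forall i x, boundary U x -> ue i x = 0)
  (ueP : forall i x, U x -> ue i x + H i x (grad (ue i) x) +
     rescaled_penalty gamma (del ^+ 2) (ue i x - ue (~~ i) x - psi i x) =
     del ^+ 2 * laplacian (ue i) x).

Let eta := eta_rate * del.
Let eta0 : 0 < eta. Proof. exact: mulr_gt0. Qed.

Let lap_coef : del ^+ 2 * (n%:R * (2 * ((2 * del)^-1 + A ^+ 2 * del / rho ^+ 2)))
  <= viscous_rate * del.
Proof.
have -> : del ^+ 2 * (n%:R * (2 * ((2 * del)^-1 + A ^+ 2 * del / rho ^+ 2))) =
   n%:R * (1 + 2 * A ^+ 2 / rho ^+ 2 * del ^+ 2) * del.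
  by field; rewrite !gt_eqF.
rewrite ler_wpM2r ?(ltW del0)// ler_wpM2l// lerD2l ler_piMr//.
  by rewrite divr_ge0 ?sqr_ge0// mulr_ge0// sqr_ge0.
by rewrite expr_le1// ltW.
Qed.

Let Adel0 : 0 < A * del. Proof. by rewrite mulr_gt0//; have := A1; lra. Qed.

Let error_split : penalized_constant * del = 2 * L * (1 + 2 * V) * (A * del) +
  2 * L * V * (A * del) + viscous_rate * del + (M * slope_rate + N * dist_rate) * del + eta * BH.
Proof. by rewrite /penalized_constant /eta; ring. Qed.

Let p1 : 0 <= 2 * L * (1 + 2 * V) * (A * del).
Proof.
rewrite mulr_ge0 ?(ltW Adel0)// mulr_ge0 ?mulr_ge0//.
by rewrite addr_ge0// mulr_ge0.
Qed.
Let p2 : 0 <= 2 * L * V * (A * del).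
Proof. by rewrite !mulr_ge0// ltW// (lt_le_trans ltr01). Qed.
Let p3 : 0 <= viscous_rate * del. Proof. by rewrite mulr_ge0// ltW. Qed.
Let p4 : 0 <= (M * slope_rate + N * dist_rate) * del.
Proof.
exact: (mulr_ge0 (addr_ge0 (mulr_ge0 M0 slope_rate_ge0)
  (mulr_ge0 N0 dist_rate_ge0)) (ltW del0)).
Qed.
Let p5 : 0 <= eta * BH. Proof. by rewrite mulr_ge0// ltW. Qed.

(** The factors [1 + eta] and [1 - eta] move the obstacle by more than it
    varies between [x] and [y]. *)
Let obstacle_slack i x y : U x -> U y -> segment_in U x y -> `|y - x| <= dist_rate * del ->
  `|psi i x - psi i y| + del <= eta * psi i y.
Proof.
move=> Ux Uy S yx; rewrite distrC; have h := psiL i S.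
have h1 : Lp * `|y - x| <= Lp * (dist_rate * del) by rewrite ler_wpM2l.
have h2 : eta * alpha <= eta * psi i y.
  by rewrite ler_wpM2l ?(ltW eta0)// psi_ge//; exact: subset_closure.
have h3 : eta * alpha = Lp * (dist_rate * del) + del.
  by rewrite /eta /eta_rate; field; rewrite gt_eqF.
by move: h h1 h2 h3; lra.
Qed.

Let scaled_lipschitz (th : R) i x y : `|th| <= 2 -> closure U x -> closure U y ->
  `|th * u i x - th * u i y| <= 2 * L * `|x - y|.
Proof.
move=> th2 cx cy; rewrite -mulrBr normrM -mulrA ler_pM//; exact: uL.
Qed.

(** If the obstacle of [(1 + eta) u] is active at [y], the slack it gained over
    [psi] makes the penalization at [x] larger than what the equation of [ue]
    allows. So the equation of [u] holds at [y], and it compares with that of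
    [ue], where the penalization is nonnegative. *)
Lemma upper_estimate i x : closure U x ->
  ue i x - (1 + eta) * u i x <= penalized_constant * del.
Proof.
have e0 := eta0; have e12 : eta <= 1 / 2 by [].
pose th := 1 + eta.
have th2 : `|th| <= 2 by rewrite ger0_norm /th; lra.
have th0 : 0 < th by rewrite /th; lra.
have lb j x' y' : closure U x' -> closure U y' ->
    `|th * u j x' - th * u j y'| <= 2 * L * `|x' - y'|.
  exact: scaled_lipschitz.
have bd j x' : boundary U x' -> ue j x' = 0 /\ th * u j x' = 0.
  by move=> bx'; rewrite ue0// u0// mulr0.
have L20 : 0 <= 2 * L by rewrite mulr_ge0.
rewrite error_split => cx.
have [|[j [x' [y [c [p [Ux' Uy S yx [idx sup tch PA [pP quad]]]]]]]]] :=
  @doubling_of_variables R n U ue (fun i x => th * u i x) (2 * L) rho V del oU cU U0 inU rho0 V0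
    L20 uec lb bd del0 delrho.
  by move=> /(_ i x cx); rewrite -/A -/th; have := p2; have := p3; have := p4; have := p5; lra.
rewrite -/A in yx PA pP quad sup.
have {}yx : `|y - x'| <= dist_rate * del by rewrite /dist_rate -mulrA.
set k := (2 * del)^-1 in tch PA pP quad.
have k0 : 0 < k by rewrite invr_gt0 mulr_gt0.
set P := (2 * k) *: (y - c) in PA pP.
have {}pP : `|p - - P| <= slope_rate * del.
  by rewrite opprK (le_trans pP)// /slope_rate mulrAC.
have {}PA : `|- P| <= A by rewrite normrN.
have [gE lE] := touch_above oU (ueC2 j) Ux' quad.
have sxi := sup i x cx; rewrite -/th in sxi.
have [neg|pos] := leP (ue j x' - th * u j y) 0.
  by rewrite -/th; have := p1; have := p2; have := p3; have := p4; have := p5; lra.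
have HH := hamiltonian_compare j (ltW del0) slope_le1 S yx PA pP.
have lap : del ^+ 2 * laplacian (ue j) x' <= viscous_rate * del.
  apply: le_trans lap_coef; rewrite ler_wpM2l// sqr_ge0//.
have := ueP j Ux'; rewrite gE.
set g := rescaled_penalty _ _ _ => pde.
have HPB : `|H j y (- P)| <= BH.
  by apply: HB; [exact: subset_closure|have := A1; lra].
have grE : grad (fun z => (- (k / th)) * sqn (z - c)) y = th^-1 *: - P.
  by rewrite grad_sqn /P scalerN scalerA -scaleNr; congr (_ *: _); field; rewrite gt_eqF.
have [|act|eq] := @supersolution_ge _ _ U H psi u uP j
  (fun z => (- (k / th)) * sqn (z - c)) y (Ck1_sqn _ _) Uy.
- apply: (filterS _ (open_nbhs_nbhs (conj oU Uy))) => y' Uy'.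
  rewrite -(ler_pM2l th0) !mulrBr !mulrA.
  have -> : th * - (k / th) = - k by field; rewrite gt_eqF.
  by have := tch y' Uy'; lra.
- have sl := obstacle_slack j Ux' Uy S yx.
  have sl' := ler_norm (psi j x' - psi j y).
  have h1 : th * psi j y <= th * (u j y - u (~~ j) y) by rewrite ler_wpM2l// ltW.
  have id1 := idx (~~ j).
  have h2 : th * psi j y = psi j y + eta * psi j y by rewrite /th; ring.
  have h3 : del <= ue j x' - ue (~~ j) x' - psi j x'.
    by move: sl sl' h1 id1 h2; lra.
  (* the equation of [ue] bounds [g] by this constant, as [ue] is above [- 2 Bu] *)
  have : viscous_rate + 2 * Bu + BH < g.
    apply: gamma_large; rewrite ler_pdivlMr ?exprn_gt0//.
    by rewrite expr2 mulrA mulVf ?gt_eqF// mul1r.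
  have h4 : th * Bu <= 2 * Bu by rewrite ler_wpM2r//; move: th2; rewrite gtr0_norm.
  have h5 : th * - u j y <= th * Bu.
    by rewrite ler_wpM2l ?(ltW th0)//; have /ler_normlP[] := uB j (subset_closure Uy).
  have h6 : viscous_rate * del <= viscous_rate by rewrite ler_piMr.
  have /ler_normlP[h7 _] : `|H j x' p| <= BH.
    apply: HB; first exact: subset_closure.
    have := ler_normD (p - - P) (- P); rewrite subrK.
    by move: pP PA slope_le1 A1; lra.
  by move: pde lap pos h4 h5 h6 h7; lra.
have g0 : 0 <= g by exact: gamma_ge0.
move: eq; rewrite grE => eq.
have i01 : 0 <= th^-1 <= 1.
  by rewrite invr_ge0 (ltW th0)/= invf_le1// /th lerDl ltW.
have cv := HC j (- P) 0 (subset_closure Uy) i01.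
rewrite scaler0 addr0 in cv.
have h1 : th * H j y (th^-1 *: - P) <= H j y (- P) + eta * H j y 0.
  apply: le_trans (ler_wpM2l (ltW th0) cv) _.
  rewrite le_eqVlt; apply/orP; left; apply/eqP.
  by rewrite /th; field; rewrite gt_eqF.
have h2 : 0 <= th * u j y + th * H j y (th^-1 *: - P).
  by rewrite -mulrDr mulr_ge0// ltW.
have /ler_normlP[_ h3] : `|H j y 0| <= BH.
  by apply: HB; [exact: subset_closure|rewrite normr0; move: A1; lra].
have h4 : eta * H j y 0 <= eta * BH by rewrite ler_wpM2l// ltW.
have /ler_normlP[h5 _] := HH.
move: sxi p1 h1 h2 h4 h5 g0 pde lap; rewrite -/th; lra.
Qed.

(** The subsolution [u] satisfies both the obstacle constraint and the
    inequality [u + H <= 0]. The slack in the former makes the penalization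
    vanish at [x], and then the latter compares with the equation of [ue]. *)
Lemma lower_estimate i x : closure U x ->
  (1 - eta) * u i x - ue i x <= penalized_constant * del.
Proof.
have e0 := eta0; have e12 : eta <= 1 / 2 by [].
pose th := 1 - eta.
have th0 : 0 < th by rewrite /th; lra.
have th2 : `|- th| <= 2 by rewrite normrN ger0_norm /th; lra.
have lb j x' y' : closure U x' -> closure U y' ->
    `|- th * u j x' - - th * u j y'| <= 2 * L * `|x' - y'|.
  exact: scaled_lipschitz.
have bd j x' : boundary U x' -> - ue j x' = 0 /\ - th * u j x' = 0.
  by move=> bx'; rewrite ue0// u0// mulr0 oppr0.
have L20 : 0 <= 2 * L by rewrite mulr_ge0.
have cne j : {within closure U, continuous (fun z => - ue j z)}.
  by move=> z; exact: continuousN (@uec j z).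
rewrite error_split => cx.
have [|[j [x' [y [c [p [Ux' Uy S yx [idx sup tch PA [pP quad]]]]]]]]] :=
  @doubling_of_variables R n U (fun i x => - ue i x) (fun i x => - th * u i x) (2 * L) rho V del
    oU cU U0 inU rho0 V0 L20 cne lb bd del0 delrho.
  by move=> /(_ i x cx); rewrite -/A -/th; have := p2; have := p3; have := p4; have := p5; lra.
rewrite -/A in yx PA pP quad sup.
have {}yx : `|y - x'| <= dist_rate * del by rewrite /dist_rate -mulrA.
set k := (2 * del)^-1 in tch PA pP quad.
have k0 : 0 < k by rewrite invr_gt0 mulr_gt0.
set P := (2 * k) *: (y - c) in PA pP.
have {}pP : `|- p - P| <= slope_rate * del.
  by rewrite -opprD normrN (le_trans pP)// /slope_rate mulrAC.
have quad' l s : U (x' + s *: delta_mx 0 l) ->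
    ue j x' + (- p) 0 l * s + (- (k + A ^+ 2 * del / rho ^+ 2)) * s ^+ 2 <=
    ue j (x' + s *: delta_mx 0 l).
  by move=> /quad; rewrite !mxE; lra.
have [gE lE] := touch_below oU (ueC2 j) Ux' quad'.
have sxi := sup i x cx; rewrite -/th in sxi.
have HH := hamiltonian_compare j (ltW del0) slope_le1 S yx PA pP.
have lap : - (viscous_rate * del) <= del ^+ 2 * laplacian (ue j) x'.
  apply: le_trans (_ : del ^+ 2 * (n%:R * (2 * - (k + A ^+ 2 * del / rho ^+ 2))) <= _).
    by rewrite !mulrN lerN2; exact: lap_coef.
  by rewrite ler_wpM2l// sqr_ge0.
have grE : grad (fun z => (k / th) * sqn (z - c)) y = th^-1 *: P.
  by rewrite grad_sqn /P scalerA; congr (_ *: _); field; rewrite gt_eqF.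
have [|obs eq] := @subsolution_le _ _ U H psi u uP j
  (fun z => (k / th) * sqn (z - c)) y (Ck1_sqn _ _) Uy.
  apply: (filterS _ (open_nbhs_nbhs (conj oU Uy))) => y' Uy'.
  rewrite -(ler_pM2l th0) !mulrBr !mulrA.
  have -> : th * k / th = k by field; rewrite gt_eqF.
  by have := tch y' Uy'; lra.
have := ueP j Ux'; rewrite gE /rescaled_penalty gamma_npos; last first.
  rewrite pmulr_lle0 ?invr_gt0 ?exprn_gt0//.
  have sl := obstacle_slack j Ux' Uy S yx; rewrite distrC in sl.
  have sl' := ler_norm (psi j y - psi j x').
  have h1 : th * (u j y - u (~~ j) y) <= th * psi j y by rewrite ler_wpM2l// ltW.
  have id1 := idx (~~ j).
  have h2 : th * psi j y = psi j y - eta * psi j y by rewrite /th; ring.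
  by have := del0; move: sl sl' h1 id1 h2; lra.
move=> pde; move: eq; rewrite grE => eq.
have i01 : 0 <= th <= 1 by rewrite (ltW th0)/= /th gerBl ltW.
have cv := HC j (th^-1 *: P) 0 (subset_closure Uy) i01.
rewrite scaler0 addr0 scalerA divff ?gt_eqF// scale1r in cv.
have h2 : th * u j y + th * H j y (th^-1 *: P) <= 0.
  by rewrite -mulrDr pmulr_rle0.
have /ler_normlP[_ h3] : `|H j y 0| <= BH.
  by apply: HB; [exact: subset_closure|rewrite normr0; move: A1; lra].
have h4 : eta * H j y 0 <= eta * BH by rewrite ler_wpM2l// ltW.
have h5 : (1 - th) * H j y 0 = eta * H j y 0 by rewrite /th; ring.
have /ler_normlP[_ h6] := HH.
move: sxi p1 cv h2 h4 h5 h6 pde lap; rewrite -/th; lra.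
Qed.

Lemma penalization_error i x : U x ->
  `|ue i x - u i x| <= (penalized_constant + eta_rate * Bu) * del.
Proof.
move=> /subset_closure cx; have := upper_estimate i cx; have := lower_estimate i cx.
have /ler_normlP[h1 h2] := uB i cx.
have : eta * u i x <= eta * Bu by rewrite ler_wpM2l// ltW.
have : eta * - u i x <= eta * Bu by rewrite ler_wpM2l// ltW.
have -> : (penalized_constant + eta_rate * Bu) * del = penalized_constant * del + eta * Bu.
  by rewrite /eta; ring.
move=> ? ? ? ?; apply/ler_normlP; split; lra.
Qed.

End fixed_eps.
Hypothesis gamma_infty : gamma s @[s --> +oo] --> +oo.

(** The smallness of [eps] makes all the conditions on [del] hold; the one that
    depends on [gamma] uses only its divergence at infinity. *)
Lemma penalization_rate : exists eps0 C : R, [/\ 0 < eps0, 0 < C &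
  forall eps, 0 < eps < eps0 -> forall ue : bool -> 'rV[R]_n -> R,
    (forall i, Ck 2 U (ue i)) ->
    (forall i, {within closure U, continuous (ue i)}) ->
    (forall i x, boundary U x -> ue i x = 0) ->
    (forall i x, U x -> ue i x + H i x (grad (ue i) x) +
       rescaled_penalty gamma eps (ue i x - ue (~~ i) x - psi i x) =
       eps * laplacian (ue i) x) ->
    forall i x, U x -> `|ue i x - u i x| <= C * Num.sqrt eps].
Proof.
have [T [_ HT]] : \forall s \near +oo, viscous_rate + 2 * Bu + BH < gamma s.
  by move/cvgryPgt : gamma_infty; exact.
pose q := 1 + A / rho + slope_rate + 2 * eta_rate + (`|T| + 1).
have q1 : 0 <= A / rho by rewrite divr_ge0 ?(ltW rho0)//; have := A1; lra.
have T0 : 0 <= `|T| by []; have TT := ler_norm T.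
have q0 : 0 < q by rewrite /q; have := slope_rate_ge0; have := eta_rate_gt0; lra.
pose d0 := q^-1; have d00 : 0 < d0 by rewrite invr_gt0.
exists (d0 ^+ 2), (Num.max (penalized_constant + eta_rate * Bu) 1); split.
- exact: exprn_gt0.
- by rewrite lt_max ltr01 orbT.
move=> eps /andP[e0 ed] ue C2 ct bd pde i x Ux.
pose del := Num.sqrt eps.
have del0 : 0 < del by rewrite sqrtr_gt0.
have epsE : eps = del ^+ 2 by rewrite sqr_sqrtr// ltW.
have deld : del < d0.
  by move: ed; rewrite epsE ltr_sqr// nnegrE ltW.
have qd : q * del < 1 by rewrite mulrC -ltr_pdivlMr// mul1r.
have m1 : 0 <= A / rho * del by rewrite mulr_ge0// ltW.
have m2 : 0 <= slope_rate * del by rewrite mulr_ge0// ltW.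
have m3 : 0 <= eta_rate * del by rewrite ltW// mulr_gt0.
have m4 : 0 <= `|T| * del by rewrite mulr_ge0// ltW.
have qE : q * del =
    del + A / rho * del + slope_rate * del + 2 * (eta_rate * del) + (`|T| * del + del).
  by rewrite /q; ring.
apply: (@le_trans _ _ ((penalized_constant + eta_rate * Bu) * del)); last first.
  by rewrite ler_wpM2r ?(ltW del0)// le_max lexx.
apply: penalization_error => //; try by move: qd qE m1 m2 m3 m4; lra.
- have : A / rho * del < 1 by move: qd qE m1 m2 m3 m4; lra.
  by rewrite mulrAC ltr_pdivrMr// mul1r.
- move=> s ds; apply: HT; apply: lt_le_trans ds.
  apply: le_lt_trans TT _; rewrite -[ltRHS]mul1r ltr_pdivlMr//.
  by move: qd qE m1 m2 m3 m4; lra.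
- by move=> j y Uy; rewrite -epsE; exact: pde.
Qed.

End estimates.

(** * The rate of convergence *)

Lemma bounded_closure_compact (R : realType) n (U : set 'rV[R]_n) :
  bounded_set U -> compact (closure U).
Proof.
move=> [M [_ HM]].
have /HM UM : M < `|M| + 1 by rewrite (le_lt_trans (ler_norm _))// ltrDl.
have cK := @closed_ball_compact R n 0 (`|M| + 1).
apply: (subclosed_compact (@closed_closure _ U) cK).
rewrite closureE => x; apply; split; first exact: (compact_closed (@norm_hausdorff _ _) cK).
by move=> y Uy /=; rewrite subr0; exact: UM.
Qed.

Lemma C1_closure_lipschitz_segment (R : realType) n (U : set 'rV[R]_n) (psi : 'rV[R]_n -> R) :
  open U -> compact (closure U) -> Ck_closure 1 U psi ->
  exists2 L, 0 <= L & forall x y, segment_in U x y -> `|psi y - psi x| <= L * `|y - x|.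
Proof.
move=> oU cU Cpsi; have [M M0 HM] := Ck_closure_partial_bounded cU Cpsi.
exists (n%:R * M) => [|x y S]; first by rewrite mulr_ge0.
have [C1 _ _] := Cpsi.
by apply: (C1_lipschitz_segment oU C1 S) => s i s01; apply: HM; exact: S.
Qed.

Unset Implicit Arguments.

Theorem theorem5p1 (R : realType) (n : nat) (U : set 'rV[R]_n)
    (gamma : R -> R) (H1 H2 : 'rV[R]_n -> 'rV[R]_n -> R)
    (psi1 psi2 : 'rV[R]_n -> R) (alpha K : R) (u1 u2 : 'rV[R]_n -> R)
    (n_ge2 : (2 <= n)%N)
    (domU : smooth_bounded_domain U)
    (gammaP : admissible_penalty gamma)
    (psi1_smooth : smooth_closure U psi1)
    (psi2_smooth : smooth_closure U psi2)
    (alpha_gt0 : 0 < alpha)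
    (psi_ge : forall x, closure U x -> alpha <= psi1 x /\ alpha <= psi2 x)
    (H1P : admissible_hamiltonian U K H1)
    (H2P : admissible_hamiltonian U K H2)
    (PhiP : exists Phi1 Phi2 : 'rV[R]_n -> R,
      [/\ strict_C1_subsolution U H1 Phi1,
          strict_C1_subsolution U H2 Phi2 &
          forall x, closure U x -> - psi2 x <= Phi1 x - Phi2 x <= psi1 x])
    (uP : obstacle_system_solution U H1 H2 psi1 psi2 u1 u2) :
  exists eps0 C : R, [/\ 0 < eps0, 0 < C &
    forall eps : R, 0 < eps < eps0 ->
    forall ue1 ue2 : 'rV[R]_n -> R,
      penalized_system_solution U gamma H1 H2 psi1 psi2 eps ue1 ue2 ->
      (Linfty_norm U (ue1 \- u1)%R
         <= (C * Num.sqrt eps)%:E)%E /\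
      (Linfty_norm U (ue2 \- u2)%R
         <= (C * Num.sqrt eps)%:E)%E].
Proof.
have [U0 oU _ bU sU] := domU.
have cU := bounded_closure_compact bU.
have [rho [V [rho0 V0 inU]]] := uniformly_inward_exists oU sU cU.
have [gsm _ g0 gpos ginf] := gammaP.
have [Phi1 [Phi2 [Phi1P Phi2P PhiD]]] := PhiP.
have [[cu1 cu2] u1P u2P ubd] := uP.
pose H (i : bool) := if i then H1 else H2.
pose psi (i : bool) := if i then psi1 else psi2.
pose u (i : bool) := if i then u1 else u2.
pose Phi (i : bool) := if i then Phi1 else Phi2.
have HP i : admissible_hamiltonian U K (H i).
  by case: i; [exact: H1P|exact: H2P].
have psi_ge' i x : closure U x -> alpha <= psi i x by case: i => /psi_ge[].
have PhiP' i : strict_C1_subsolution U (H i) (Phi i).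
  by case: i; [exact: Phi1P|exact: Phi2P].
have PhiD' i x : closure U x -> Phi i x - Phi (~~ i) x <= psi i x.
  by case: i => /PhiD/andP[] //=; rewrite /Phi /psi /=; lra.
have cu i : {within closure U, continuous (u i)}.
  by case: i; [exact: cu1|exact: cu2].
have uP' i : viscosity_solution U (obstacle_operator (H i) (psi i) (u (~~ i))) (u i).
  by case: i; [exact: u1P|exact: u2P].
have u0 i x : boundary U x -> u i x = 0 by case: i => /ubd[].
have [L L0 uL] := limit_lipschitz oU cU U0 HP alpha_gt0 psi_ge' PhiP' PhiD' cu uP' u0.
have [Bu Bu0 uB] := limit_bounded cU cu.
have [||Lp Lp0 psiL] := @bool_bound R (fun i L => forall x y, segment_in U x y ->
    `|psi i y - psi i x| <= L * `|y - x|).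
- by move=> i a b ab Ha x y /Ha /le_trans; apply; rewrite ler_wpM2r.
- by case; [exact: C1_closure_lipschitz_segment oU cU (psi1_smooth 1)
           |exact: C1_closure_lipschitz_segment oU cU (psi2_smooth 1)].
pose A := 2 * (2 * L) + 4 * (2 * L) * V + 1.
have [||BH BH0 HB] := @bool_bound R (fun i B => forall x p, closure U x ->
    `|p| <= 2 * A + 1 -> `|H i x p| <= B).
- by move=> i a b ab Ha x p cx /(Ha _ _ cx) /le_trans; exact.
- by move=> i; exact: hamiltonian_bounded cU (HP i) _.
have [||M M0 HM] := @bool_bound R (fun i M => forall x p q, closure U x ->
    `|p| <= A -> `|q - p| <= 1 -> `|H i x q - H i x p| <= M * `|q - p|).
- move=> i a b ab Ha x p q cx pA pq; apply: (le_trans (Ha x p q cx pA pq)).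
  by rewrite ler_wpM2r.
- by move=> i; exact: hamiltonian_lipschitz_p cU (HP i) _.
have HN i x y p : segment_in U x y -> `|H i y p - H i x p| <= n%:R * `|K| * `|y - x|.
  move=> S; apply: (le_trans (hamiltonian_lipschitz_x oU (HP i) p S)).
  by rewrite ler_wpM2r// ler_wpM2l// ler_norm.
have [eps0 [C [eps00 C0 rate]]] := penalization_rate oU cU U0 rho0 V0 inU alpha_gt0
  psi_ge' Lp0 psiL L0 uL Bu0 uB u0 uP' g0 (fun s s0 => (gpos s s0).1) BH0 HB
  (fun i => hamiltonian_convex (HP i)) M0 HM (mulr_ge0 (ler0n R n) (normr_ge0 K)) HN ginf.
exists eps0, C; split => // eps epsP ue1 ue2 [[sm1 sm2] pde1 pde2 bd].
pose ue (i : bool) := if i then ue1 else ue2.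
have R_ i x : U x -> `|ue i x - u i x| <= C * Num.sqrt eps.
  apply: (rate _ epsP).
  - by case; [have [] := sm1 2|have [] := sm2 2].
  - by case; [have [] := sm1 2|have [] := sm2 2].
  - by case=> z /bd[].
  - by case; [exact: pde1|exact: pde2].
by split; apply: ge_ereal_sup => _ [x Ux <-]; rewrite lee_fin;
  [exact: (R_ true x Ux)|exact: (R_ false x Ux)].
Qed.
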